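(* Assume the standing setup. Then $\deg(\ell^d)\neq 0$, and for every subset $F\subseteq V$ of size $d$, $$\mathrm{ord}_{[F]}(\deg(\ell^d)) = \begin{cases}-1 & \text{if } F \text{ is a facet of } \Delta,\\ 0 & \text{otherwise,}\end{cases}$$ as integers.
   Context: Standing setup. $k$ is a field, $d\ge 2$ is an integer, and $\Delta$ is a simplicial complex of dimension $d-1$ with vertex set $V=\{1,\dots,n\}$. $\Delta$ is a connected $k$-homology manifold: $\Delta$ is connected and, for every nonempty face $G$, the link of $G$ has the same homology over $k$ as a sphere of dimension $d-|G|-1$ (in particular every $(d-2)$-dimensional face lies in exactly two facets). $\Delta$ is oriented: if $\mathrm{char}\,k\neq 2$, an orientation is a choice, for each facet, of an ordering of its vertices up to even permutations, such that for every $(d-2)$-face the two orientations induced on it by the two facets containing it are opposite; a facet ordered $v_1,\dots,v_d$ induces on the face omitting $v_i$ the ordering $v_1,\dots,\widehat{v_i},\dots,v_d$ if $i-1$ is even, and the opposite orientation if $i-1$ is odd. If $\mathrm{char}\,k=2$, every such $\Delta$ is regarded as oriented. For a facet $F=\{j_1<\dots<j_d\}$, $\epsilon_F\in\{\pm1\}$ is the sign of the permutation taking $(j_1,\dots,j_d)$ to the chosen ordering ($\epsilon_F=1$ if $\mathrm{char}\,k=2$). Let $K=k(a_{i,j}:1\le i\le d,\ 1\le j\le n)$ with the $a_{i,j}$ independent indeterminates, let $K[\Delta]$ be the Stanley–Reisner ring of $\Delta$ over $K$ in variables $x_1,\dots,x_n$, and for a face $G$ write $x_G=\prod_{j\in G}x_j$.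 For a subset $F=\{j_1<\dots<j_d\}\subseteq V$ of size $d$, $[F]\in k[a_{i,j}]$ is the determinant of the $d\times d$ matrix whose $(i,m)$ entry is $a_{i,j_m}$; it is an irreducible polynomial, and $\mathrm{ord}_{[F]}:K^\times\to\mathbb Z$ is the valuation given by order of vanishing along $[F]$. Set $\theta_i=\sum_{j}a_{i,j}x_j$ and $H(\Delta)=K[\Delta]/(\theta_1,\dots,\theta_d)$, graded with pieces $H^q(\Delta)$. $H^d(\Delta)$ is one-dimensional and $\deg:H^d(\Delta)\to K$ is the $K$-linear isomorphism with $\deg(x_F)=\epsilon_F/[F]$ for every facet $F$; for an element $y$ of $H(\Delta)$ (or of $K[\Delta]$), $\deg(y)$ means $\deg$ of its degree-$d$ component (image). Let $\ell$ be the image of $x_1+\dots+x_n$ in $H(\Delta)$. *)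

(* Defs.v *)
From HB Require Import structures.
From mathcomp Require Import all_boot all_order all_algebra.
From mathcomp Require Import mpoly.
Set Implicit Arguments. Unset Strict Implicit. Unset Printing Implicit Defensive.
Import Order.TTheory GRing.Theory.
Local Open Scope ring_scope.

(* Vertices 1..n are represented by 'I_n (vertex j+1 <-> ordinal j).
   A face is a finite set of vertices; a complex is a set of faces. *)

Definition simplicial_complex (n : nat) (Delta : {set {set 'I_n}}) :=
  forall F G : {set 'I_n}, F \in Delta -> G \subset F -> G \in Delta.

Definition has_vertex_set (n : nat) (Delta : {set {set 'I_n}}) :=
  forall v : 'I_n, [set v] \in Delta.

(* dimension d-1: largest face has d vertices *)
Definition has_dim (n d : nat) (Delta : {set {set 'I_n}}) :=
  (exists2 F, F \in Delta & #|F| = d) /\ (forall F, F \in Delta -> #|F| <= d)%N.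

Definition facet (n : nat) (Delta : {set {set 'I_n}}) (F : {set 'I_n}) : bool :=
  (F \in Delta) && [forall G : {set 'I_n}, (G \in Delta) ==> (F \subset G) ==> (G == F)].

Definition connected_complex (n : nat) (Delta : {set {set 'I_n}}) :=
  forall u v : 'I_n, connect (fun x y => [set x; y] \in Delta) u v.

Definition link (n : nat) (Delta : {set {set 'I_n}}) (G : {set 'I_n}) : {set {set 'I_n}} :=
  [set H in Delta | (H :&: G == set0) && (H :|: G \in Delta)].

(* Chains are indexed by all subsets of 'I_n; a q-subset S (q >= 1) is an
   oriented (q-1)-simplex with its vertices in increasing order.
   bd L q is the matrix (rows = sources, row-vector convention) of the
   boundary map from C_{q-1}(L) to C_{q-2}(L): S |-> sum_p (-1)^p (S minus its
   p-th vertex), p 0-indexed.  For q = 1 this is the augmentation to the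
   empty face, so the homology computed is reduced homology. *)
Definition bd (k : fieldType) (n : nat) (L : {set {set 'I_n}}) (q : nat)
  : 'M[k]_#|{: {set 'I_n}}| :=
  \matrix_(r, c)
    (let S : {set 'I_n} := @enum_val _ {: {set 'I_n}} r in
     let T : {set 'I_n} := @enum_val _ {: {set 'I_n}} c in
     if [&& S \in L, #|S| == q, T \subset S & #|S :\: T| == 1%N]
     then \sum_(v in S :\: T) (-1) ^+ (index v (enum S))
     else 0).

(* dimension over k of the reduced homology group H~_{q-1}(L; k) *)
Definition homdim (k : fieldType) (n : nat) (L : {set {set 'I_n}}) (q : nat) : nat :=
  (#|[set S in L | #|S| == q]| - \rank (bd k L q) - \rank (bd k L q.+1))%N.

(* connected k-homology manifold of dimension d-1: every nonempty face G has
   link with the reduced homology of a (d-|G|-1)-sphere, i.e.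
   H~_{q-1} = k if q-1 = d-|G|-1 and 0 otherwise. *)
Definition homology_manifold (k : fieldType) (n d : nat) (Delta : {set {set 'I_n}}) :=
  forall G, G \in Delta -> G != set0 ->
    forall q : nat, homdim k (link Delta G) q = (q == d - #|G|)%N.

Definition inv_count (n : nat) (s : seq 'I_n) : nat :=
  (\sum_(p < size s) \sum_(q < size s)
     ((p < q)%N && (nth 0%N (map val s) q < nth 0%N (map val s) p)%N))%N.

Definition seq_sign (n : nat) (s : seq 'I_n) : int := (-1) ^+ inv_count s.

(* orientation (as a sign w.r.t. the increasing order) induced by the
   ordering s of a facet on the face obtained by omitting v:
   v at (0-indexed) position i gives the remaining ordering if i is even,
   and the opposite orientation if i is odd. *)
Definition ind_sign (n : nat) (s : seq 'I_n) (v : 'I_n) : int :=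
  (-1) ^+ (index v s) * seq_sign (rem v s).

Definition is_orientation (n : nat) (Delta : {set {set 'I_n}})
  (ord : {set 'I_n} -> seq 'I_n) :=
  (forall F, facet Delta F -> perm_eq (ord F) (enum F)) /\
  (forall F F' (v v' : 'I_n), facet Delta F -> facet Delta F' -> F != F' ->
     v \in F -> v' \in F' -> F :\ v = F' :\ v' ->
     ind_sign (ord F) v = - ind_sign (ord F') v').

Notation Pa k d n := {mpoly k[(d * n)%N]}.
Notation KK k d n := {fraction {mpoly k[(d * n)%N]}}.

Definition avar (k : fieldType) (d n : nat) (i : 'I_d) (j : 'I_n) : Pa k d n :=
  'X_(mxvec_index i j).

(* [F] : determinant of the d x d matrix (a_{i, j_m}) with j_1 < ... < j_d
   the elements of F (enum F lists F in increasing order). *)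
Definition bracket (k : fieldType) (d n : nat) (F : {set 'I_n}) : Pa k d n :=
  \det (\matrix_(i < d, m < d)
          (if onth (enum F) m is Some j then avar k i j else 0)).

Definition pdvd (R : comRingType) (p f : R) : Prop := exists g, f = p * g.

(* ord_p(x) = e, for p irreducible: x = p^e * f / g with f, g not divisible by p *)
Definition ord_is (R : idomainType) (p : R) (x : {fraction R}) (e : int) : Prop :=
  exists f g : R, [/\ ~ pdvd p f, ~ pdvd p g & x = (tofrac p) ^ e * (tofrac f / tofrac g)].

Definition epsF (k : fieldType) (d n : nat) (ord : {set 'I_n} -> seq 'I_n)
  (F : {set 'I_n}) : KK k d n :=
  if (2 \in [pchar k])%N then 1 else (seq_sign (ord F))%:~R.

Definition aK (k : fieldType) (d n : nat) (i : 'I_d) (j : 'I_n) : KK k d n :=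
  tofrac (avar k i j).

Definition theta (k : fieldType) (d n : nat) (i : 'I_d) : {mpoly (KK k d n)[n]} :=
  \sum_(j < n) aK k i j *: 'X_j.

Definition xF (K : fieldType) (n : nat) (F : {set 'I_n}) : {mpoly K[n]} :=
  \prod_(j in F) 'X_j.

Definition ellp (K : fieldType) (n : nat) : {mpoly K[n]} := \sum_(j < n) 'X_j.

(* D : K[x] -> K is "deg of the degree-d component of the image in H(Delta)":
   K-linear, zero off degree d, zero on the Stanley-Reisner ideal (spanned
   by the monomials whose support is a non-face), zero on (theta_1..theta_d),
   and deg(x_F) = eps_F / [F] on facets. *)
Definition is_deg (k : fieldType) (d n : nat) (Delta : {set {set 'I_n}})
  (ord : {set 'I_n} -> seq 'I_n) (D : {mpoly (KK k d n)[n]} -> KK k d n) :=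
  [/\ forall (c : KK k d n) p q, D (c *: p + q) = c * D p + D q,
      forall m : 'X_{1..n}, mdeg m != d -> D 'X_[m] = 0,
      forall m : 'X_{1..n}, [set j | m j != 0%N] \notin Delta -> D 'X_[m] = 0,
      forall (i : 'I_d) q, D (@theta k d n i * q) = 0 &
      forall F, facet Delta F -> D (xF _ F) = epsF k d ord F / tofrac (bracket k d F)].

(* Main.v *)
(** Fix a facet [F] and expand the degree map in the local ring at [[F]]. Every face of
size between 1 and [d - 1] lies in at least two facets, hence in a facet [G] other than
[F], and Cramer's rule for [theta] at [G] trades a repeated variable of a monomial
supported on that face for variables outside [G]. So [deg x^m] has at most a simple pole
along [[F]], and the residue is a functional supported on [F]: modulo [[F]] the columns
indexed by [F] satisfy one linear relation [lam], and the residue of [deg p] is a nonzero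
multiple of [p(lam)]. At [p = l^d] this is [(sum lam)^d], which does not vanish.

If [F] is not a facet, a specialisation of the [a_ij] killing [[F]] but not the numerator
of [deg l^d] is needed. When some facet [G] meets [F] in at most [d - 2] vertices, make
[[F]] and [[G]] vanish and no other [[G']], and look at the residue at [G] instead.
Otherwise every facet meets [F] in [d - 1] vertices, [Delta] is the suspension of the
boundary of the simplex [F], and [deg l^d] is computed explicitly at a suitable point. *)

Require Import Defs.
From HB Require Import structures.
From mathcomp Require Import all_boot all_order all_algebra perm zify ring.
From mathcomp Require Import mpoly.
Import GRing.Theory.
Local Open Scope ring_scope.
Set Implicit Arguments. Unset Strict Implicit. Unset Printing Implicit Defensive.

(** * Faces of homology manifolds *)

Section Complex.

Variables (k : fieldType) (n d : nat) (Delta : {set {set 'I_n}}).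
Hypothesis cplx : simplicial_complex Delta.
Hypothesis dimD : has_dim d Delta.
Hypothesis manD : homology_manifold k d Delta.

Lemma bd_eq0 (L : {set {set 'I_n}}) (q : nat) :
  (forall S, S \in L -> #|S| != q) -> bd k L q = 0.
Proof.
move=> Lq; apply/matrixP=> r c; rewrite !mxE /=; case: ifP => // /and4P[SL Sq _ _].
by move: (Lq _ SL); rewrite Sq.
Qed.

Lemma bd0 (L : {set {set 'I_n}}) : bd k L 0 = 0.
Proof.
apply/matrixP=> r c; rewrite !mxE /=; case: ifP => // /and4P[_ /eqP/cards0_eq S0 _].
by rewrite S0 set0D cards0.
Qed.

(** Only the empty face lies below a vertex, so every column but [c0] vanishes. *)
Lemma mxrank_bd1 (L : {set {set 'I_n}}) : (\rank (bd k L 1) <= 1)%N.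
Proof.
pose c0 : 'I_#|{: {set 'I_n}}| := enum_rank (set0 : {set 'I_n}).
suff: bd k L 1 = col c0 (bd k L 1) *m delta_mx 0 c0.
  by move=> ->; exact: mulmx_max_rank.
apply/matrixP=> r c; rewrite [RHS]mxE big_ord1 [delta_mx _ _ _ _]mxE eqxx /=.
have [->|ne] := eqVneq c c0; first by rewrite /= mulr1 [RHS]mxE.
rewrite mulr0 mxE /=; case: ifP => // /and4P[_ S1 TS SD]; case/negP: ne.
rewrite /c0 -(enum_valK c); apply/eqP; congr enum_rank; apply/eqP.
rewrite -cards_eq0.
by move: (cardsID (enum_val c) (enum_val r)); rewrite (setIidPr TS) (eqP S1) (eqP SD) addn1 => -[->].
Qed.

(** Purity. The link of a smaller non-empty maximal face would have the empty face as its only face,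
    hence homology at [q = 0], whereas the manifold condition puts it at [q = d - #|F| > 0]. That
    condition does not cover the empty face, which is treated apart. *)
Lemma card_facet F : facet Delta F -> #|F| = d.
Proof.
case/andP=> FD /forallP maxF.
have [F0|F0] := eqVneq F set0.
  case: dimD => [[G GD Gd] _].
  by have /implyP/(_ GD) := maxF G; rewrite {1}F0 sub0set => /eqP <-.
have Fd : (#|F| <= d)%N by apply: dimD.2.
have [//|ltd] : #|F| = d \/ (#|F| < d)%N by lia.
have L0 S : S \in link Delta F -> S = set0.
  rewrite inE => /and3P[SD SF SUF].
  have /implyP/(_ SUF) := maxF (S :|: F); rewrite subsetUr => e.
  by apply/eqP; rewrite -subset0 -(eqP SF) subsetI subxx -(eqP e) subsetUl.
have := manD FD F0 0; rewrite /homdim bd0 mxrank0 (bd_eq0 (q := 1)); last first.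
  by move=> S /L0 ->; rewrite cards0.
rewrite mxrank0 !subn0 (_ : (0 == d - #|F|)%N = false); last by lia.
move/eqP; rewrite cards_eq0 => /eqP/setP/(_ set0).
rewrite !inE cards0 eqxx set0I eqxx set0U FD andbT /= andbT.
by rewrite (cplx FD) ?sub0set.
Qed.

Lemma facetE F : facet Delta F = (F \in Delta) && (#|F| == d).
Proof.
apply/idP/andP => [fF|[FD /eqP Fd]]; first by rewrite (card_facet fF); case/andP: fF.
rewrite /facet FD; apply/forallP=> G; apply/implyP=> GD; apply/implyP=> FG.
by rewrite eq_sym eqEcard FG Fd; apply: dimD.2.
Qed.

Lemma in_facet s : s \in Delta -> exists2 G, facet Delta G & s \subset G.
Proof.
move=> sD; have [G maxG sG] := @maxset_exists _ (mem Delta) s sD.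
have [GD maxG'] := maxsetP maxG; exists G => //; rewrite /facet.
rewrite (_ : G \in Delta) //; apply/forallP=> H; apply/implyP=> HD; apply/implyP=> GH.
by rewrite (maxG' H).
Qed.

(** The link has vertex set [W] and no edges. Vanishing homology at [q = 0] forces the augmentation
    to have rank 1, and homology of dimension [#|W| - 1] at [q = 1] must have dimension 1. *)
Lemma card_ridge_link H : H \in Delta -> (0 < #|H|)%N -> #|H|.+1 = d ->
  #|[set v | (v \notin H) && (v |: H \in Delta)]| = 2%N.
Proof.
move=> HD H0 Hd; set W := [set v | _].
have Hn0 : H != set0 by rewrite -card_gt0.
have T0 : [set S in link Delta H | #|S| == 0%N] = [set set0].
  apply/setP=> S; rewrite !inE cards_eq0; have [->|] := eqVneq S set0; last by rewrite andbF.
  by rewrite andbT set0I eqxx set0U HD (cplx HD) ?sub0set.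
have T1 : [set S in link Delta H | #|S| == 1%N] = [set [set v] | v in W].
  apply/setP=> S; rewrite !inE; apply/andP/imsetP => [[]|[v]].
    move=> /and3P[SD SH SHD] /cards1P[v Sv]; exists v => //; move: SD SH SHD.
    rewrite Sv inE => _ /eqP vH ->; rewrite andbT; apply/negP=> vH'.
    by have := in_set0 v; rewrite -vH inE vH' inE eqxx.
  rewrite inE => /andP[vH vHD] ->; rewrite cards1 vHD (cplx vHD) ?subsetUl //.
  by split=> //; rewrite andbT /= -subset0; apply/subsetP=> x; rewrite !inE => /andP[/eqP ->]; rewrite (negPf vH).
have cT1 : #|[set S in link Delta H | #|S| == 1%N]| = #|W|.
  by rewrite T1 card_imset //; apply: set1_inj.
have b2 : bd k (link Delta H) 2 = 0.
  apply: bd_eq0 => S; rewrite inE => /and3P[_ SH /dimD.2].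
  by rewrite cardsU (eqP SH) cards0; apply: contraTneq => ->; rewrite -Hd; lia.
have := manD HD Hn0 0; have := manD HD Hn0 1.
rewrite /homdim b2 bd0 !mxrank0 cT1 T0 cards1.
(* Subtraction is truncated, so the condition at [q = 0] only bounds the rank from below; this gives
   the upper bound. *)
have := mxrank_bd1 (link Delta H); rewrite (_ : (d - #|H|)%N = 1%N); last by lia.
by rewrite eqxx /=; set b := \rank _; clearbody b; case: b => [|[|]]; lia.
Qed.

(** If the first facet found is [F], dropping a vertex [g] outside [s] leaves a ridge that contains
    [s] and lies in a second facet. *)
Lemma facet_avoiding s F : s \in Delta -> (0 < #|s| < d)%N ->
  exists G, [/\ facet Delta G, s \subset G & G != F].
Proof.
move=> sD /andP[s0 sd].
have [G fG sG] := in_facet sD.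
have [GF|] := eqVneq G F; last by exists G.
have Gd := card_facet fG; have GD : G \in Delta by case/andP: fG.
have /properP[_ [g gG gs]] : s \proper G by rewrite properEcard sG Gd.
have Gg : #|G :\ g|.+1 = d by rewrite -Gd (cardsD1 g G) gG.
have sGg : s \subset G :\ g by rewrite subsetD1 sG gs.
have GgD : G :\ g \in Delta by apply: cplx GD _; apply: subD1set.
have := card_ridge_link GgD (leq_trans s0 (subset_leq_card sGg)) Gg.
rewrite (cardsD1 g) !inE eqxx /= setD1K // GD => -[] /eqP/cards1P[v].
move/setP/(_ v); rewrite !inE eqxx => /and3P[vg]; rewrite vg /= => vG vD.
exists (v |: G :\ g); split.
- by rewrite facetE vD cardsU1 !inE vg vG /= add1n Gg.
- by apply: subset_trans sGg _; apply: subsetUr.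
- by rewrite -GF; apply: contraNneq vG => <-; rewrite !inE eqxx.
Qed.

End Complex.

(** * Minors and monomials *)

Section Minors.

Variables (d n : nat).

(** Taken at any matrix over any ring, so that brackets can be followed through substitutions and
    evaluations. *)
Definition bracket_of (R : comNzRingType) (a : 'M[R]_(d, n)) (F : {set 'I_n}) : R :=
  \det (\matrix_(i < d, m < d) (if onth (enum F) m is Some j then a i j else 0)).

Lemma bracket_of_map (R S : comNzRingType) (f : {rmorphism R -> S}) (a : 'M[R]_(d, n)) F :
  bracket_of (map_mx f a) F = f (bracket_of a F).
Proof.
rewrite -det_map_mx; congr (\det _); apply/matrixP=> i m; rewrite !mxE.
by case: onth => [j|]; rewrite ?mxE ?rmorph0.
Qed.

Lemma bracket_of_enum (F : {set 'I_n}) : #|F| = d ->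
  exists c : 'I_d -> 'I_n, [/\ injective c, F = [set c i | i in 'I_d] &
    forall (R : comNzRingType) (a : 'M[R]_(d, n)), bracket_of a F = \det (colsub c a)].
Proof.
move=> Fd; pose c i := enum_val (cast_ord (esym Fd) i); exists c.
have injc : injective c by move=> i j /enum_val_inj/cast_ord_inj.
split=> //.
  apply/esym/eqP; rewrite eqEcard card_imset // card_ord Fd leqnn andbT.
  by apply/subsetP=> _ /imsetP[i _ ->]; apply: enum_valP.
move=> R a; congr (\det _); apply/matrixP=> i m; rewrite !mxE.
suff -> : onth (enum F) m = Some (c m) by [].
rewrite onthE (nth_map (c m)) -?cardE ?Fd //; congr Some.
by rewrite /c /enum_val; apply: set_nth_default; rewrite -cardE Fd.
Qed.

Lemma bracket_of_row0 (R : comNzRingType) (a : 'M[R]_(d, n)) (F : {set 'I_n}) i :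
  {in F, forall j, a i j = 0} -> bracket_of a F = 0.
Proof.
move=> a0; rewrite /bracket_of (expand_det_row _ i) big1 // => m _; rewrite mxE.
case e : onth => [j|]; rewrite ?mul0r // a0 ?mul0r //.
by rewrite -mem_enum; apply/onthP; exists m.
Qed.

Lemma bracket_of_neq0 (R : idomainType) (a : 'M[R]_(d, n)) (F : {set 'I_n}) : #|F| = d ->
  (forall y : 'rV_d, {in F, forall j, (y *m a) 0 j = 0} -> y = 0) -> bracket_of a F != 0.
Proof.
move=> /bracket_of_enum[c [_ -> ->]] y0; apply/det0P => -[y yn0 ya0].
case/negP: yn0; apply/eqP/y0 => _ /imsetP[s _ ->].
have /rowP/(_ s) := ya0; rewrite !mxE => e; rewrite -[RHS]e.
by apply: eq_bigr => i _; rewrite mxE.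
Qed.

(** Multiplying [a *m w = 0] by the adjugate turns the chosen columns into a scalar matrix, and row
    [r] isolates the entry at [c r]. *)
Lemma cramer_colsub (R : comNzRingType) (a : 'M[R]_(d, n)) (c : 'I_d -> 'I_n)
    (w : 'cV_n) r : a *m w = 0 ->
  \det (colsub c a) * w (c r) 0 =
  - \sum_(j | j \notin codom c) (\adj (colsub c a) *m a) r j * w j 0.
Proof.
move=> aw; have e s : (\adj (colsub c a) *m a) r (c s) = \det (colsub c a) *+ (r == s).
  have := mul_adj_mx (colsub c a) => /matrixP/(_ r s); rewrite [RHS]mxE => <-.
  by rewrite [LHS]mxE [RHS]mxE; apply: eq_bigr => i _; rewrite [colsub _ _ _ _]mxE.
have : (\adj (colsub c a) *m a *m w) r 0 = 0 by rewrite -mulmxA aw mulmx0 mxE.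
rewrite mxE (bigID (mem (codom c))) /= (bigD1 (c r)) ?codom_f //= e eqxx mulr1n.
rewrite big1 => [|j /andP[/codomP[s ->] ne]]; last first.
  by rewrite e (_ : (r == s) = false) ?mul0r //; apply: contraNF ne => /eqP ->.
by rewrite addr0 => /eqP; rewrite addr_eq0 => /eqP.
Qed.

End Minors.

Lemma sum_delta (R : nzRingType) d (x : R) (i : 'I_d) (f : 'I_d -> R) :
  \sum_s x *+ (s == i) * f s = x * f i.
Proof.
rewrite (bigD1 i) //= eqxx mulr1n big1 ?addr0 // => s /negPf ->.
by rewrite mulr0n mul0r.
Qed.

(* Replacing row [r] of [M] by [w j * e_i - w i * e_j] gives a matrix that still
   annihilates [w]. *)
Lemma cofactor_ker (R : idomainType) d (M : 'M[R]_d) (w : 'cV_d) r i j : M *m w = 0 ->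
  cofactor M r i * w j 0 = cofactor M r j * w i 0.
Proof.
move=> Mw.
pose u : 'rV_d := w j 0 *: delta_mx 0 i - w i 0 *: delta_mx 0 j.
pose N := \matrix_(s < d) (if s == r then u else row s M).
have cofN s : cofactor N r s = cofactor M r s.
  congr (_ * \det _); apply/matrixP=> x y; rewrite !mxE.
  by rewrite eq_sym (negPf (neq_lift _ _)) mxE.
have uE s : u 0 s = w j 0 *+ (s == i) - w i 0 *+ (s == j).
  by rewrite !mxE eqxx /= !mulr_natr.
have detN : \det N = cofactor M r i * w j 0 - cofactor M r j * w i 0.
  rewrite (expand_det_row _ r) -[in RHS](cofN i) -[in RHS](cofN j).
  rewrite (eq_bigr (fun s => w j 0 *+ (s == i) * cofactor N r s
             - w i 0 *+ (s == j) * cofactor N r s)) => [|s _]; last first.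
    by rewrite [N r s]mxE eqxx uE mulrBl.
  rewrite sumrB; congr (_ - _).
    by rewrite sum_delta mulrC.
  by rewrite sum_delta mulrC.
have Nw : N *m w = 0.
  apply/colP=> s; rewrite [LHS]mxE [RHS]mxE.
  have [->|ne] := eqVneq s r.
    rewrite (eq_bigr (fun t => w j 0 *+ (t == i) * w t 0
               - w i 0 *+ (t == j) * w t 0)) => [|t _]; last first.
      by rewrite [N r t]mxE eqxx uE mulrBl.
    by rewrite sumrB !sum_delta mulrC subrr.
  have /colP/(_ s) := Mw; rewrite [LHS]mxE [RHS]mxE => e; rewrite -[RHS]e.
  by apply: eq_bigr => t _; rewrite [N s t]mxE (negPf ne) mxE.
(* A non-zero [w] in the kernel of [N] makes [\det N] vanish, which is the claim. *)
have [w0|wn0] := eqVneq w 0; first by rewrite w0 !mxE !mulr0.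
apply/eqP; rewrite -subr_eq0 -detN -det_tr; apply/det0P; exists w^T.
  by rewrite -trmx0 (inj_eq trmx_inj).
by rewrite -trmx_mul Nw trmx0.
Qed.

Definition msup n (m : 'X_{1..n}) : {set 'I_n} := [set j | m j != 0%N].

Section Multinomials.
Variable n : nat.
Implicit Type m : 'X_{1..n}.

Lemma msupD m1 m2 : msup (m1 + m2)%MM = msup m1 :|: msup m2.
Proof. by apply/setP=> j; rewrite !inE mnmDE addn_eq0 negb_and. Qed.

Lemma msupU (j : 'I_n) : msup U_(j)%MM = [set j].
Proof. by apply/setP=> i; rewrite !inE mnm1E (eq_sym i); case: (j == i). Qed.

Lemma mdeg_msup m : mdeg m = (\sum_(j in msup m) m j)%N.
Proof.
rewrite mdegE (bigID (mem (msup m))) /= [X in (_ + X)%N]big1 ?addn0 //.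
by move=> j; rewrite inE negbK => /eqP.
Qed.

Lemma msup_repeat m : (#|msup m| < mdeg m)%N -> exists2 j, j \in msup m & (1 < m j)%N.
Proof.
move=> lt; apply/exists_inP; apply: contraLR lt => /exists_inPn H.
rewrite -leqNgt mdeg_msup -sum1_card leq_sum // => j jm.
by rewrite leqNgt H.
Qed.

Lemma card_msup_le m : (#|msup m| <= mdeg m)%N.
Proof. by rewrite mdeg_msup -sum1_card leq_sum // => j; rewrite inE lt0n. Qed.

Lemma mpolyX_squarefree (R : comNzRingType) m : #|msup m| = mdeg m ->
  'X_[m] = \prod_(j in msup m) 'X_j :> {mpoly R[n]}.
Proof.
move=> e; have m1 j : j \in msup m -> m j = 1%N.
  move=> jm; have : (\sum_(i in msup m) (m i - 1) == 0)%N.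
    by rewrite sumnB => [|i]; rewrite ?sum1_card -?mdeg_msup ?e ?subnn // inE lt0n.
  by rewrite sum_nat_eq0 => /forall_inP/(_ j jm); move: jm; rewrite inE; lia.
rewrite mpolyXE_id (bigID (mem (msup m))) /= [X in _ * X]big1 ?mulr1.
  by apply: eq_bigr => j /m1 ->.
by move=> j; rewrite inE negbK => /eqP ->.
Qed.

Lemma mpolyX_set (R : comNzRingType) (F : {set 'I_n}) : exists2 m,
  msup m = F & 'X_[m] = \prod_(j in F) 'X_j :> {mpoly R[n]}.
Proof.
exists [multinom (j \in F : nat) | j < n].
  by apply/setP=> j; rewrite inE mnmE; case: (j \in F).
rewrite mpolyXE_id [RHS]big_mkcond; apply: eq_bigr => j _.
by rewrite mnmE; case: (j \in F).
Qed.

End Multinomials.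

(** * Clearing denominators in the degree map *)

Lemma tofrac_inj (R : idomainType) : injective (@tofrac R).
Proof. by move=> x y /eqP; rewrite tofrac_eq => /eqP. Qed.

Lemma mulr_monomials n (R : comNzRingType) (E : {scalar {mpoly R[n]}}) (p : {mpoly R[n]}) :
  (forall m, E (p * 'X_[m]) = 0) -> forall q, E (p * q) = 0.
Proof.
move=> H q; rewrite (mpolyE q) mulr_sumr linear_sum big1 // => m _.
by rewrite -scalerAr linearZ /= H mulr0.
Qed.

Lemma map_mpoly_expand n (R S : nzRingType) (f : {rmorphism R -> S}) (p : {mpoly R[n]}) :
  map_mpoly f p = \sum_(m <- msupp p) f p@_m *: 'X_[m].
Proof.
rewrite {1}(mpolyE p) raddf_sum; apply: eq_bigr => m _.
by rewrite /= map_mpolyZ map_mpolyX.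
Qed.

(** The prescribed values vanish off degree [d], so a sum over the finitely many monomials of degree
    at most [d] loses nothing. *)
Lemma scalar_of_monomials n d (R : comNzRingType) (e : 'X_{1..n} -> R) :
  (forall m, mdeg m != d -> e m = 0) ->
  exists E : {scalar {mpoly R[n]}}, forall m, E 'X_[m] = e m.
Proof.
move=> e0; pose E0 (p : {mpoly R[n]}) : R := \sum_(m : 'X_{1..n < d.+1}) p@_m * e m.
have linE : linear_for *%R E0.
  move=> c p q; rewrite /E0 mulr_sumr -big_split; apply: eq_bigr => m _.
  by rewrite mcoeffD mcoeffZ mulrDl mulrA.
pose M := GRing.isLinear.Build R {mpoly R[n]} R *%R E0 linE.
pose E : {scalar {mpoly R[n]}} := HB.pack E0 M.
exists E => m; rewrite /= /E0; have [md|md] := eqVneq (mdeg m) d.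
  have lt : (mdeg m < d.+1)%N by rewrite md.
  rewrite (bigD1 (BMultinom lt)) //= mcoeffX eqxx mul1r big1 ?addr0 // => i ne.
  rewrite mcoeffX (_ : (m == i) = false) ?mul0r //.
  by apply: contraNF ne => /eqP mi; apply/eqP/val_inj; rewrite /= mi.
rewrite (e0 _ md) big1 // => i _; rewrite mcoeffX.
by case: eqP => [<-|]; rewrite ?mul0r // e0 // mulr0.
Qed.

Section DegreeForm.

Variables (d n : nat) (Delta : {set {set 'I_n}}).

(* For [c = 1] over a field this is the degree map; a general [c] clears denominators
   and [eps F] stands for the sign of the orientation of [F]. *)
Definition degree_form (R : comNzRingType) (a : 'M[R]_(d, n)) (c : R)
    (eps : {set 'I_n} -> R) (E : {scalar {mpoly R[n]}}) :=
  [/\ forall m, mdeg m != d -> E 'X_[m] = 0,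
      forall m, msup m \notin Delta -> E 'X_[m] = 0,
      forall i q, E ((\sum_j a i j *: 'X_j) * q) = 0 &
      forall F, facet Delta F -> E (\prod_(j in F) 'X_j) * bracket_of a F = eps F * c].

(** The values on monomials are pushed through [f]; by linearity the condition on the theta need
    only be checked against monomials. *)
Lemma degree_form_map (R S : comNzRingType) (f : {rmorphism R -> S}) a c eps E :
  @degree_form R a c eps E -> exists E' : {scalar {mpoly S[n]}},
    degree_form (map_mx f a) (f c) (f \o eps) E' /\
    forall p, E' (map_mpoly f p) = f (E p).
Proof.
move=> [Ed Ef Et Ex].
have [|E' E'X] := @scalar_of_monomials n d S (fun m => f (E 'X_[m])).
  by move=> m /Ed ->; rewrite rmorph0.
have E'f p : E' (map_mpoly f p) = f (E p).
  rewrite map_mpoly_expand [in RHS](mpolyE p) !linear_sum raddf_sum.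
  by apply: eq_bigr => m _; rewrite !linearZ /= rmorphM -E'X.
exists E'; split=> //; split=> [m /Ed|m /Ef|i q|F /Ex].
- by rewrite E'X => ->; rewrite rmorph0.
- by rewrite E'X => ->; rewrite rmorph0.
- apply: mulr_monomials => m.
  suff -> : (\sum_j map_mx f a i j *: 'X_j) * 'X_[m] =
      map_mpoly f ((\sum_j a i j *: 'X_j) * 'X_[m]) by rewrite E'f Et rmorph0.
  rewrite rmorphM /= map_mpolyX; congr (_ * _); rewrite raddf_sum.
  by apply: eq_bigr => j _; rewrite mxE /= map_mpolyZ map_mpolyX.
- move=> e; rewrite bracket_of_map /= -rmorphM -e rmorphM -E'f rmorph_prod.
  congr (E' _ * _); apply: eq_bigr => j _; exact/esym/map_mpolyX.
Qed.

Section Reduction.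

Variables (R : comNzRingType) (a : 'M[R]_(d, n)) (c : R) (eps : {set 'I_n} -> R).
Variable E : {scalar {mpoly R[n]}}.
Hypothesis cplx : simplicial_complex Delta.
Hypothesis degE : degree_form a c eps E.

Lemma degree_form_nonface m q : msup m \notin Delta -> E ('X_[m] * q) = 0.
Proof.
case: degE => _ Ef _ _ mD; apply: mulr_monomials => m'.
rewrite -mpolyXD Ef //; apply: contra mD => /cplx; apply.
by rewrite msupD subsetUl.
Qed.

(** Puts the condition on the theta in the form of a kernel vector, to which Cramer's rule and
    cofactors apply. *)
Lemma degree_form_theta q : a *m \col_j E ('X_j * q) = 0.
Proof.
case: degE => _ _ Et _; apply/colP=> i; rewrite [RHS]mxE -[RHS](Et i q) mxE.
rewrite mulr_suml linear_sum; apply: eq_bigr => j _.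
by rewrite mxE -scalerAl linearZ.
Qed.

Lemma msup_exchange (m : 'X_{1..n}) i j : (1 < m j)%N ->
  msup (m - U_(j) + U_(i))%MM = i |: msup m.
Proof.
move=> mj; apply/setP=> t; rewrite !inE mnmDE mnmBE !mnm1E (eq_sym i) (eq_sym j).
case: (t =P j) => [->|_]; case: (_ == i) => /=; rewrite ?addn1 ?addn0 ?subn0 //.
by rewrite subn1; case: (m j) mj => [|[]].
Qed.

(** Cramer's rule at [G] for the values of [x_i] times [x^m / x_j]. Since [m j > 1], replacing one
    [x_j] by [x_i] keeps [j] in the support and adds [i] ([msup_exchange]). *)
Lemma degree_form_exchange (m : 'X_{1..n}) j (G : {set 'I_n}) : #|G| = d -> j \in G -> (1 < m j)%N ->
  exists (s : 'I_d -> 'I_n) r, bracket_of a G * E 'X_[m] =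
    - \sum_(i | i \notin G) (\adj (colsub s a) *m a) r i * E 'X_[m - U_(j) + U_(i)].
Proof.
move=> Gd jG mj; have [s [_ Gs ->]] := bracket_of_enum Gd; exists s.
move: jG; rewrite Gs => /imsetP[r _ jr]; exists r.
have UE i : 'X_i * 'X_[m - U_(j)] = 'X_[m - U_(j) + U_(i)] :> {mpoly R[n]}.
  by rewrite -mpolyXD addmC.
have := cramer_colsub s r (degree_form_theta 'X_[m - U_(j)]).
rewrite [(\col_i _) (s r) 0]mxE -jr UE submK => [->|]; last by rewrite lep1mP; lia.
congr (- _); apply: eq_big => [i|i _]; last by rewrite [X in _ * X]mxE UE.
by congr negb; apply/codomP/imsetP => [[x ->]|[x _ ->]]; exists x.
Qed.

End Reduction.

Lemma mdeg_exchange (m : 'X_{1..n}) i j : (0 < m j)%N ->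
  mdeg (m - U_(j) + U_(i))%MM = mdeg m.
Proof.
move=> mj; rewrite -[in RHS](@submK _ U_(j)%MM m) ?lep1mP -?lt0n //.
by rewrite !mdegD !mdeg1.
Qed.

Hypothesis cplx : simplicial_complex Delta.
Hypothesis facetd : forall F, facet Delta F = (F \in Delta) && (#|F| == d).

Section Integral.

Variables (R : idomainType) (a : 'M[R]_(d, n)) (eps : {set 'I_n} -> R).
Variable D : {scalar {mpoly {fraction R}[n]}}.
Hypothesis degD : degree_form (map_mx (@tofrac R) a) 1 (@tofrac R \o eps) D.
Variable B : pred {set 'I_n}.
Hypothesis d_gt0 : (0 < d)%N.
Hypothesis coverB : forall s, s \in Delta -> (0 < #|s| < d)%N ->
  exists G, [/\ facet Delta G, s \subset G & B G].

(* Each exchange step costs one bracket from [B] and enlarges the support, so [d] steps suffice. *)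
Definition denominator : R :=
  (\prod_(G | facet Delta G) bracket_of a G) * (\prod_(G | facet Delta G && B G) bracket_of a G) ^+ d.

(** Exchanges at facets from [B] enlarge the support until it has [d] vertices. Only the final
    squarefree monomial calls for a bracket of an arbitrary facet, so brackets outside [B] enter the
    denominator once. *)
Lemma integral_monomial m :
  exists f, tofrac f = tofrac denominator * D 'X_[m].
Proof.
have [Dd Df _ Dx] := degD.
set P := \prod_(G | facet Delta G) bracket_of a G.
set g := \prod_(G | facet Delta G && B G) bracket_of a G.
have main t : forall m, mdeg m = d -> (d - #|msup m| <= t)%N ->
    exists f, tofrac f = tofrac (P * g ^+ t) * D 'X_[m].
  elim: t => [|t IHt] {}m md.
    have := card_msup_le m; rewrite md => le1 le2.
    have mcard : #|msup m| = mdeg m by lia.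
    have [mD|mD] := boolP (msup m \in Delta); last by exists 0; rewrite Df // mulr0 tofrac0.
    have fm : facet Delta (msup m) by rewrite facetd mD mcard md eqxx.
    pose P' := \prod_(G | facet Delta G && (G != msup m)) bracket_of a G.
    have PE : P = bracket_of a (msup m) * P' by rewrite /P (bigD1 (msup m)).
    exists (P' * eps (msup m)); rewrite expr0 mulr1 PE mpolyX_squarefree // !tofracM.
    by have := Dx _ fm; rewrite mulr1 bracket_of_map /= => <-; ring.
  move=> mt.
  have [mD|mD] := boolP (msup m \in Delta); last by exists 0; rewrite Df // mulr0 tofrac0.
  have [ltd|ged] := ltnP #|msup m| d; last first.
    have [|f fE] := IHt m md; first by lia.
    by exists (g * f); rewrite tofracM fE exprS !tofracM; ring.
  have m0 : (0 < #|msup m|)%N.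
    rewrite lt0n cards_eq0; apply: contraTneq d_gt0 => m0.
    by rewrite -md mdeg_msup m0 big_set0.
  have [|G [fG mG BG]] := coverB mD; first by rewrite m0.
  have Gd : #|G| = d by move: fG; rewrite facetd => /andP[_ /eqP].
  have [j jm mj] : exists2 j, j \in msup m & (1 < m j)%N by apply: msup_repeat; rewrite md.
  have jG := subsetP mG _ jm.
  have [s [r e]] := degree_form_exchange degD Gd jG mj.
  have IH i : i \notin G -> exists f,
      tofrac f = tofrac (P * g ^+ t) * D 'X_[m - U_(j) + U_(i)].
    move=> iG; apply: IHt; first by rewrite mdeg_exchange // ltnW.
    by rewrite msup_exchange // cardsU1 (contra (subsetP mG i)) //; lia.
  have [h hE] : exists h : 'I_n -> R, forall i, i \notin G ->
      tofrac (h i) = tofrac (P * g ^+ t) * D 'X_[m - U_(j) + U_(i)].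
    (* Made boolean and vacuous on [G], the condition lets all numerators be chosen at once. *)
    have IH' i : exists f, (i \notin G) ==>
        (tofrac f == tofrac (P * g ^+ t) * D 'X_[m - U_(j) + U_(i)]).
      have [iG|iG] := boolP (i \in G); first by exists 0.
      by have [f fE] := IH i iG; exists f; rewrite fE eqxx.
    exists (fun i => xchoose (IH' i)) => i iG.
    by have /implyP/(_ iG)/eqP := xchooseP (IH' i).
  pose g' := \prod_(H | (facet Delta H && B H) && (H != G)) bracket_of a H.
  have gE : g = bracket_of a G * g' by rewrite /g (bigD1 G) ?fG.
  exists (- g' * \sum_(i | i \notin G) (\adj (colsub s a) *m a) r i * h i).
  rewrite exprS [in X in _ * (X * _)]gE.
  transitivity (tofrac (P * g ^+ t) * tofrac g' * (tofrac (bracket_of a G) * D 'X_[m])); last first.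
    by rewrite !tofracM; ring.
  rewrite -bracket_of_map e mulNr tofracN tofracM mulrN; congr (- _).
  rewrite rmorph_sum /= [in RHS]mulrAC [in RHS]mulrC; congr (_ * _); rewrite mulr_sumr.
  apply: eq_bigr => i iG; rewrite tofracM hE // mulrCA; congr (_ * (_ * _)).
  by rewrite -map_mxsub -map_mx_adj -map_mxM [in RHS]mxE.
have [md|md] := eqVneq (mdeg m) d; last by exists 0; rewrite Dd // mulr0 tofrac0.
by apply: main; rewrite ?leq_subr.
Qed.

(** Unlike the fraction-valued [D], the form [E] can be specialised where brackets vanish. *)
Lemma integral_degree_form : exists E : {scalar {mpoly R[n]}},
  degree_form a denominator eps E /\
  forall p, tofrac (E p) = tofrac denominator * D (map_mpoly (@tofrac R) p).
Proof.
have [Dd Df Dt Dx] := degD.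
have IH m : exists f, tofrac f == tofrac denominator * D 'X_[m].
  by have [f fE] := integral_monomial m; exists f; rewrite fE.
pose e m := xchoose (IH m).
have eE m : tofrac (e m) = tofrac denominator * D 'X_[m] by apply/eqP/(xchooseP (IH m)).
have [|E EX] := @scalar_of_monomials n d R e.
  by move=> m md; apply: tofrac_inj; rewrite eE Dd // mulr0 tofrac0.
have ED p : tofrac (E p) = tofrac denominator * D (map_mpoly (@tofrac R) p).
  rewrite map_mpoly_expand [in LHS](mpolyE p) !linear_sum raddf_sum mulr_sumr.
  by apply: eq_bigr => m _; rewrite !linearZ /= tofracM EX eE; ring.
exists E; split=> //; split=> [m md|m mD|i q|F fF]; apply: tofrac_inj.
- by rewrite ED map_mpolyX Dd // mulr0 tofrac0.
- by rewrite ED map_mpolyX Df // mulr0 tofrac0.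
- have te : map_mpoly (@tofrac R) (\sum_j a i j *: 'X_j) =
      \sum_j map_mx (@tofrac R) a i j *: 'X_j.
    by rewrite raddf_sum; apply: eq_bigr => j _; rewrite mxE /= map_mpolyZ map_mpolyX.
  by rewrite ED tofrac0 (rmorphM (map_mpoly (@tofrac R))) /= te Dt mulr0.
- rewrite tofracM ED !tofracM mulrAC -mulrA mulrC; congr (_ * _).
  have := Dx _ fF; rewrite mulr1 bracket_of_map /= => <-; rewrite mulrC; congr (D _ * _).
  by rewrite rmorph_prod; apply: eq_bigr => j _; rewrite /= map_mpolyX.
Qed.

End Integral.

End DegreeForm.

(** * Residues and specialisations *)

Section Congruence.

Variables (n : nat) (R : comNzRingType) (E : {scalar {mpoly R[n]}}).

(* Equality in the Gorenstein quotient of the polynomial ring determined by [E]. *)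
Definition cong (p p' : {mpoly R[n]}) := forall q, E (p * q) = E (p' * q).

Lemma cong_refl p : cong p p. Proof. by []. Qed.

Lemma cong_trans p2 p1 p3 : cong p1 p2 -> cong p2 p3 -> cong p1 p3.
Proof. by move=> e1 e2 q; rewrite e1. Qed.

Lemma congM p1 p1' p2 p2' : cong p1 p1' -> cong p2 p2' -> cong (p1 * p2) (p1' * p2').
Proof. by move=> e1 e2 q; rewrite -mulrA e1 mulrCA e2 mulrCA mulrA. Qed.

Lemma congD p1 p1' p2 p2' : cong p1 p1' -> cong p2 p2' -> cong (p1 + p2) (p1' + p2').
Proof. by move=> e1 e2 q; rewrite !mulrDl !linearD /= e1 e2. Qed.

Lemma congZ x p p' : cong p p' -> cong (x *: p) (x *: p').
Proof. by move=> e q; rewrite -!scalerAl !linearZ /= e. Qed.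

Lemma congX p p' t : cong p p' -> cong (p ^+ t) (p' ^+ t).
Proof. by move=> e; elim: t => [|t IH] //; rewrite !exprS; apply: congM. Qed.

Lemma cong_prod (I : Type) (r : seq I) (P : pred I) (F F' : I -> {mpoly R[n]}) :
  (forall i, P i -> cong (F i) (F' i)) -> cong (\prod_(i <- r | P i) F i) (\prod_(i <- r | P i) F' i).
Proof. by move=> e; apply: big_ind2 => //; apply: congM. Qed.

Lemma congE p p' : cong p p' -> E p = E p'.
Proof. by move/(_ 1); rewrite !mulr1. Qed.

End Congruence.

Section Residue.

Variables (d n : nat) (Delta : {set {set 'I_n}}) (R : idomainType).
Variables (a : 'M[R]_(d, n)) (c : R) (eps : {set 'I_n} -> R) (E : {scalar {mpoly R[n]}}).
Variable G0 : {set 'I_n}.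
Hypothesis cplx : simplicial_complex Delta.
Hypothesis facetd : forall F, facet Delta F = (F \in Delta) && (#|F| == d).
Hypothesis pure : forall s, s \in Delta -> exists2 G, facet Delta G & s \subset G.
Hypothesis degE : degree_form Delta a c eps E.
Hypothesis brkG : forall G, facet Delta G -> G != G0 -> bracket_of a G != 0.
Hypothesis EG : forall G, facet Delta G -> G != G0 -> E (\prod_(j in G) 'X_j) = 0.

(** A facet containing the support cannot be [G0], so its bracket can be cancelled; exchanges
    enlarge the support, which stays outside [G0], until it is a facet where [E] vanishes. *)
Lemma residue_support m : ~~ (msup m \subset G0) -> E 'X_[m] = 0.
Proof.
have [Ed Ef _ _] := degE; have [t le_t] := ubnP (d - #|msup m|).
elim: t => // t IHt in m le_t *; move=> mG0.
have [md|] := eqVneq (mdeg m) d; last exact: Ed.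
have [mD|] := boolP (msup m \in Delta); last exact: Ef.
have [ltd|ged] := ltnP #|msup m| d; last first.
  have mcard : #|msup m| = mdeg m by have := card_msup_le m; lia.
  rewrite mpolyX_squarefree // EG ?facetd ?mD ?mcard ?md ?eqxx //.
  by apply: contraNneq mG0 => ->.
have [G fG mG] := pure mD.
have GG0 : G != G0 by apply: contraNneq mG0 => <-.
have Gd : #|G| = d by move: fG; rewrite facetd => /andP[_ /eqP].
have [j jm mj] : exists2 j, j \in msup m & (1 < m j)%N by apply: msup_repeat; rewrite md.
have [s [r e]] := degree_form_exchange degE Gd (subsetP mG _ jm) mj.
apply: (mulfI (brkG fG GG0)); rewrite mulr0 e big1 ?oppr0 // => i iG.
rewrite IHt ?mulr0 // msup_exchange //.
  by rewrite cardsU1 (contra (subsetP mG i)) //; lia.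
by apply: contra mG0; apply: subset_trans; apply: subsetUr.
Qed.

Lemma residue_outside j q : j \notin G0 -> E ('X_j * q) = 0.
Proof.
move=> jG; apply: mulr_monomials => m; rewrite -mpolyXD residue_support //.
by rewrite msupD msupU; apply: contra jG => /subsetP; apply; rewrite !inE eqxx.
Qed.

(** The values of the [x_(s i) * q] form a kernel vector of the square matrix on [G0], hence are
    proportional to the cofactors [lam]. So [lam i * l] is congruent to [(\sum_i lam i) * x_(s i)];
    the claim is the product over all [i]. *)
Lemma residue_power (s : 'I_d -> 'I_n) r : injective s -> G0 = [set s i | i in 'I_d] ->
  (\prod_i cofactor (colsub s a) r i) * E ((\sum_j 'X_j) ^+ d) =
  (\sum_i cofactor (colsub s a) r i) ^+ d * E (\prod_(j in G0) 'X_j).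
Proof.
move=> injs G0s; set lam := cofactor (colsub s a) r.
have ell : cong E (\sum_j 'X_j) (\sum_i 'X_(s i)).
  move=> q; rewrite (bigID (mem G0)) /= mulrDl linearD /= [X in _ + X](_ : _ = 0) ?addr0.
    by rewrite [in LHS]G0s big_imset //= => x y _ _; apply: injs.
  by rewrite mulr_suml linear_sum big1 // => j /residue_outside ->.
have lamE i j q : lam i * E ('X_(s j) * q) = lam j * E ('X_(s i) * q).
  pose w := \col_i E ('X_(s i) * q).
  suff /(cofactor_ker r i j) : colsub s a *m w = 0 by rewrite !mxE.
  have /colP aw := degree_form_theta degE q; apply/colP=> x.
  rewrite -[RHS](aw x) [LHS]mxE [RHS]mxE [RHS](bigID (mem G0)) /= [X in _ = _ + X]big1.
    rewrite addr0 G0s big_imset /=; last by move=> ? ? _ _; apply: injs.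
    by apply: eq_bigr => i' _; rewrite !mxE.
  by move=> j' /residue_outside e; rewrite [X in _ * X]mxE e mulr0.
have lamell i : cong E (lam i *: \sum_j 'X_j) ((\sum_i lam i) *: 'X_(s i)).
  move=> q; rewrite -!scalerAl !linearZ /= ell mulr_suml linear_sum mulr_sumr mulr_suml.
  by apply: eq_bigr => j _; apply: lamE.
have /congE := @cong_prod _ _ E _ (index_enum 'I_d) xpredT _ _ (fun i _ => lamell i).
rewrite !scaler_prod !prodr_const card_ord !linearZ /= => ->.
by rewrite [in RHS]G0s big_imset //= => x y _ _; apply: injs.
Qed.

End Residue.

Section Specialize.

Variables (k : fieldType) (d n : nat).

Definition generic_mx : 'M[Pa k d n]_(d, n) := \matrix_(i, j) avar k i j.

Lemma bracket_generic_mx F : bracket k d F = bracket_of generic_mx F.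
Proof.
congr (\det _); apply/matrixP=> i m; rewrite !mxE.
by case: onth => // j; rewrite mxE.
Qed.

(** The target is again the polynomial ring: entries not set to zero can stay generic, whatever the
    size of [k]. *)
Definition subst (v : 'M[Pa k d n]_(d, n)) : Pa k d n -> Pa k d n :=
  comp_mpoly [tuple mxvec v 0 i | i < d * n].

HB.instance Definition _ v := GRing.RMorphism.on (subst v).

Lemma subst_generic_mx v : map_mx (subst v) generic_mx = v.
Proof.
apply/matrixP=> i j; rewrite !mxE /subst /avar comp_mpolyXU.
by rewrite -tnth_nth tnth_mktuple mxvecE.
Qed.

Definition mask_mx (W : 'I_d -> 'I_n -> bool) : 'M[Pa k d n]_(d, n) :=
  \matrix_(i, j) (if W i j then avar k i j else 0).

Lemma eval_mask (w : 'M[k]_(d, n)) W :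
  map_mx (meval (fun i => mxvec w 0 i)) (mask_mx W) = \matrix_(i, j) (if W i j then w i j else 0).
Proof.
apply/matrixP=> i j; rewrite !mxE; case: ifP => _; last exact: rmorph0.
by rewrite /avar /= mevalXU mxvecE.
Qed.

(** Evaluated at the 0/1 matrix of the transversal [s], the columns of [F] form a permutation
    matrix. *)
Lemma bracket_of_mask_neq0 (W : 'I_d -> 'I_n -> bool) (s : 'I_d -> 'I_n) (F : {set 'I_n}) : #|F| = d -> injective s ->
  (forall i, s i \in F) -> (forall i, W i (s i)) -> bracket_of (mask_mx W) F != 0.
Proof.
move=> Fd injs sF Ws; pose w : 'M[k]_(d, n) := \matrix_(i, j) (j == s i)%:R.
apply/eqP=> /(congr1 (meval (fun i => mxvec w 0 i))); rewrite -bracket_of_map eval_mask rmorph0.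
apply/eqP/bracket_of_neq0 => // y y0; apply/rowP=> i; rewrite [RHS]mxE -[RHS](y0 _ (sF i)).
rewrite mxE (bigD1 i) //= big1 => [|i' ne]; rewrite !mxE.
  by rewrite Ws eqxx mulr1 addr0.
by rewrite (inj_eq injs) eq_sym (negPf ne); case: ifP; rewrite mulr0.
Qed.

(** The sum is the determinant with row [r] replaced by ones. At the 0/1 matrix of [s \o p] it
    becomes that of a permutation matrix so modified, which is invertible. *)
Lemma cofactor_mask_neq0 (W : 'I_d -> 'I_n -> bool) (s : 'I_d -> 'I_n) (p : 'I_d -> 'I_d) r : injective s ->
  bijective p -> (forall i, i != r -> W i (s (p i))) ->
  \sum_i cofactor (colsub s (mask_mx W)) r i != 0.
Proof.
move=> injs bijp Wp; pose w : 'M[k]_(d, n) := \matrix_(i, j) (j == s (p i))%:R.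
pose N := \matrix_(i, j) (if i == r then 1 else (j == p i)%:R : k).
apply/eqP=> /(congr1 (meval (fun i => mxvec w 0 i))); rewrite rmorph0 rmorph_sum /=.
suff -> : \sum_i meval (fun i => mxvec w 0 i) (cofactor (colsub s (mask_mx W)) r i) = \det N.
  apply/eqP/det0P => -[y yn0 /rowP yN]; case/negP: yn0; apply/eqP.
  (* Column [p i] of [y *m N = 0] reads [y_i + y_r = 0] if [i != r] and [y_r = 0] if [i = r]. *)
  have yE i : y 0 i * (i != r)%:R + y 0 r = 0.
    have := yN (p i); rewrite !mxE (bigD1 r) //= !mxE eqxx mulr1.
    have [-> e|ne] := eqVneq i r.
      rewrite mulr0 add0r -[RHS]e big1 ?addr0 // => i' /negPf ne.
      by rewrite mxE ne (bij_eq bijp) eq_sym ne mulr0.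
    rewrite mulr1 addrC (bigD1 i) //= mxE (negPf ne) eqxx mulr1 big1 ?addr0 //.
    move=> i' /andP[/negPf ne' /negPf ne2].
    by rewrite mxE ne' (bij_eq bijp) eq_sym ne2 mulr0.
  have yr : y 0 r = 0 by rewrite -(yE r) eqxx mulr0 add0r.
  apply/rowP=> i; rewrite [RHS]mxE; have := yE i; rewrite yr addr0.
  by have [->|] := eqVneq i r; rewrite ?mulr1.
rewrite (expand_det_row _ r); apply: eq_bigr => i _.
rewrite mxE eqxx mul1r rmorphM rmorph_sign -det_map_mx; congr (_ * \det _).
apply/matrixP=> x y; have := eval_mask w W => /matrixP/(_ (lift r x) (s (lift i y))).
rewrite !mxE => e; rewrite [LHS]e (inj_eq injs) [_ == r]eq_sym (negPf (neq_lift _ _)).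
have [->|_] := eqVneq (lift i y) (p (lift r x)); last by case: ifP.
by rewrite Wp // eq_sym neq_lift.
Qed.

End Specialize.

(** * The suspension of the boundary of a simplex *)

(** Only the terms of degree at most 1 in [x] survive. *)
Lemma cong_binomial n (R : comNzRingType) (E : {scalar {mpoly R[n]}}) (u x : {mpoly R[n]}) t :
  cong E (x * x) 0 -> cong E ((u - x) ^+ t.+1) (u ^+ t.+1 - t.+1%:R *: (u ^+ t * x)).
Proof.
move=> xx; elim: t => [|t IH]; first by rewrite !expr1 expr0 scale1r mul1r.
rewrite exprSr; apply: cong_trans (congM IH (@cong_refl _ _ E (u - x))) _.
have -> : (u ^+ t.+1 - t.+1%:R *: (u ^+ t * x)) * (u - x) =
  u ^+ t.+2 - t.+2%:R *: (u ^+ t.+1 * x) + t.+1%:R *: (x * x * u ^+ t).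
  by rewrite -!mul_mpolyC !mpolyC_nat !exprS -(addn1 t.+1) natrD; ring.
rewrite -[X in cong E _ X]addr0; apply: congD => //.
rewrite -(scaler0 _ t.+1%:R) -(mul0r (u ^+ t)).
exact/congZ/congM.
Qed.

Section Suspension.

Variables (d n : nat) (Delta : {set {set 'I_n}}) (R : idomainType) (tau : R).
Variables (f : 'I_d.+2 -> 'I_n) (p q : 'I_n).
Let F := [set f i | i in 'I_d.+2].
Hypothesis injf : injective f.
Hypothesis pF : p \notin F.
Hypothesis qF : q \notin F.
Hypothesis pq : p != q.

(* Chosen so that in the quotient [x_q = - x_p], [x_p ^ 2 = 0] and
   [x_(f i) = tau * x_(f ord_max) - (i == 0) * x_p] for [i != ord_max]. *)
Definition suspension_matrix : 'M[R]_(d.+2, n) := \matrix_(i, j)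
  (if j == p then (i == ord0)%:R + (i == ord_max)%:R else
   if j == q then (i == ord_max)%:R else
   if j == f ord_max then - tau *+ (i != ord_max) else (j == f i)%:R).

Let v := suspension_matrix.

Lemma pole_p i : (f i == p) = false.
Proof. by apply: contraNF pF => /eqP <-; apply: imset_f. Qed.

Lemma pole_q i : (f i == q) = false.
Proof. by apply: contraNF qF => /eqP <-; apply: imset_f. Qed.

Lemma suspension_mul (y : 'rV_d.+2) :
  [/\ forall s, s != ord_max -> (y *m v) 0 (f s) = y 0 s,
      (y *m v) 0 (f ord_max) = - tau * \sum_(i | i != ord_max) y 0 i,
      (y *m v) 0 p = y 0 ord0 + y 0 ord_max & (y *m v) 0 q = y 0 ord_max].
Proof.
have pick (g : 'I_d.+2 -> R) s : \sum_i g i * (i == s)%:R = g s.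
  by rewrite (bigD1 s) //= eqxx mulr1 big1 ?addr0 // => i /negPf ->; rewrite mulr0.
split=> [s sm|||].
- rewrite mxE -[RHS](pick (y 0)); apply: eq_bigr => i _.
  by rewrite mxE pole_p pole_q !(inj_eq injf) (negPf sm) eq_sym.
- rewrite mxE mulr_sumr [RHS]big_mkcond; apply: eq_bigr => i _.
  by rewrite mxE pole_p pole_q eqxx; case: (i != ord_max); rewrite ?mulr1n ?mulr0n ?mulr0 // mulrC.
- rewrite mxE -(pick (y 0) ord0) -(pick (y 0) ord_max) -big_split; apply: eq_bigr => i _.
  by rewrite mxE eqxx mulrDr.
- rewrite mxE -(pick (y 0) ord_max); apply: eq_bigr => i _.
  by rewrite mxE eq_sym (negPf pq) eqxx.
Qed.

Lemma card_suspension w u : u \notin F -> #|u |: F :\ f w| = d.+2.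
Proof.
move=> uF; rewrite cardsU1 inE (negPf uF) andbF /= add1n.
have := cardsD1 (f w) F; rewrite imset_f // card_imset // card_ord => ->.
by rewrite add1n.
Qed.

(** In a left kernel vector, the columns [f s] give the coordinates [s != ord_max]; if [w] is one of
    them, column [f ord_max] recovers it because [tau != 0]. The pole gives the last coordinate. *)
Lemma suspension_bracket_of w u : tau != 0 -> u \in [set p; q] ->
  bracket_of v (u |: F :\ f w) != 0.
Proof.
move=> tau0 upq; have uF : u \notin F by move: upq; rewrite !inE => /orP[] /eqP ->.
apply: bracket_of_neq0; first exact: card_suspension.
move=> y y0; have [ys ym yp yq] := suspension_mul y.
have yF s : s != w -> (y *m v) 0 (f s) = 0.
  by move=> sw; apply: y0; rewrite !inE (inj_eq injf) sw imset_f ?orbT.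
have yu : (y *m v) 0 u = 0 by apply: y0; rewrite !inE eqxx.
have small s : s != ord_max -> y 0 s = 0.
  move=> sm; have [sw|sw] := eqVneq s w; last by rewrite -ys // yF.
  have := yF ord_max; rewrite -sw eq_sym sm ym => /(_ isT)/eqP.
  rewrite mulf_eq0 oppr_eq0 (negPf tau0) /= (bigD1 s) //= big1 ?addr0 => [/eqP //|i].
  by move=> /andP[im is_]; rewrite -ys // yF // -sw.
have ymax : y 0 ord_max = 0.
  move: upq yu; rewrite !inE => /orP[] /eqP ->; last by rewrite yq.
  by rewrite yp small ?add0r.
apply/rowP=> s; rewrite [RHS]mxE.
by have [->|/small] := eqVneq s ord_max.
Qed.

Variables (c : R) (eps : {set 'I_n} -> R) (E : {scalar {mpoly R[n]}}).
Hypothesis cplx : simplicial_complex Delta.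
Hypothesis facetd : forall G, facet Delta G = (G \in Delta) && (#|G| == d.+2).
Hypothesis pure : forall s, s \in Delta -> exists2 G, facet Delta G & s \subset G.
Hypothesis facet_shape : forall G, facet Delta G ->
  exists w u, u \in [set p; q] /\ G = u |: F :\ f w.
Hypothesis FD : F \notin Delta.
Hypothesis p_facet : facet Delta (p |: F :\ f ord_max).
Hypothesis degE : degree_form Delta v c eps E.
Hypothesis eps0 : forall G, eps G != 0.
Hypothesis c0 : c != 0.

(* With [y = x_(f ord_max)] and [Lam = 1 + d.+1 * tau], one gets [l = Lam * y - x_p], and
   [x_F = 0] gives [tau * E (l ^ d.+2) = Lam ^ d.+1 * (1 - tau) * E (y ^ d.+1 * x_p)]. *)
Lemma suspension_ell_neq0 : tau != 0 -> 1 - tau != 0 -> 1 + d.+1%:R * tau != 0 ->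
  E ((\sum_j 'X_j) ^+ d.+2) != 0.
Proof.
move=> tau0 tau1; set Lam := 1 + _ => Lam0.
have [_ _ Et Ex] := degE.
have nonface m : msup m \notin Delta -> cong E 'X_[m] 0.
  by move=> mD r; rewrite mul0r linear0 (degree_form_nonface cplx degE).
have other u : u \notin F -> u != p -> u != q -> cong E 'X_u 0.
  move=> uF up uq; apply: nonface; rewrite msupU; apply/negP=> /pure[G /facet_shape].
  move=> [w [u' [u'pq ->]]]; rewrite sub1set !inE (negPf uF) andbF orbF => /eqP uu'.
  by move: u'pq; rewrite -uu' !inE (negPf up) (negPf uq).
have XpXq : cong E ('X_p * 'X_q) 0.
  rewrite -mpolyXD; apply: nonface; rewrite msupD !msupU; apply/negP=> /pure[G /facet_shape].
  move=> [w [u [_ ->]]]; rewrite subUset !sub1set !inE (negPf pF) (negPf qF) !andbF !orbF.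
  by move=> /andP[/eqP pu /eqP qu]; move: pq; rewrite pu qu eqxx.
set y : {mpoly R[n]} := 'X_(f ord_max).
have sumF (g : 'I_n -> {mpoly R[n]}) : \sum_j g j =
    \sum_s g (f s) + (g p + g q) + \sum_(j | [&& j \notin F, j != p & j != q]) g j.
  rewrite (bigID (mem F)) /= {1}/F big_imset /=; last by move=> ? ? _ _; apply: injf.
  rewrite (bigD1 p) //= (bigD1 q) /=; last by rewrite qF eq_sym.
  rewrite -!addrA; congr (_ + (_ + (_ + _))); apply: eq_bigl => j.
  by rewrite -andbA.
have row i : cong E (\sum_s v i (f s) *: 'X_(f s) + (v i p *: 'X_p + v i q *: 'X_q)) 0.
  move=> r; rewrite mul0r linear0 -[RHS](Et i r) sumF [in RHS]mulrDl linearD /=.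
  rewrite [X in _ = _ + X](_ : _ = 0) ?addr0 // mulr_suml linear_sum big1 // => j.
  by move=> /and3P[jF jp jq]; rewrite -scalerAl linearZ /= (other j) // mul0r linear0 mulr0.
(* The last row of the matrix vanishes on [F] and equals 1 at both poles. *)
have Xq : cong E 'X_q (- 'X_p).
  move=> r; have := row ord_max r.
  rewrite big1 ?add0r => [|s _]; last first.
    rewrite !mxE pole_p pole_q eqxx !(inj_eq injf); case: (s =P ord_max) => _; last by rewrite scale0r.
    by rewrite mulr0n scale0r.
  rewrite !mxE !eqxx (eq_sym q) (negPf pq) /= add0r !scale1r mul0r linear0 mulrDl linearD /= mulNr linearN /=.
  by move/eqP; rewrite addrC addr_eq0 => /eqP.
have XpXp : cong E ('X_p * 'X_p) 0.
  move=> r; have := Xq ('X_p * r).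
  rewrite mulrCA mulrA XpXq !mul0r linear0 mulNr linearN mulrA /= => /esym/eqP.
  by rewrite oppr_eq0 => /eqP.
pose h (s : 'I_d.+2) : {mpoly R[n]} := if s == ord_max then y else tau *: y - (s == ord0)%:R *: 'X_p.
have Xf s : cong E 'X_(f s) (h s).
  rewrite /h; case: (s =P ord_max) => [->//|/eqP sm] r; have := row s r.
  rewrite mul0r linear0 (bigD1 s) //= (bigD1 ord_max) //= 1?eq_sym // big1 ?addr0; last first.
    move=> t /andP[/negPf ts /negPf tm].
    by rewrite !mxE pole_p pole_q !(inj_eq injf) tm ts scale0r.
  rewrite !mxE !pole_p !pole_q !eqxx !(inj_eq injf) (eq_sym q) (negPf pq) (negPf sm) /= scale0r.
  rewrite mulr1n !addr0 scale1r scaleNr !mulrDl !mulNr !linearD !linearN /= => /eqP.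
  by rewrite -addrA addr_eq0 opprD opprK (eq_sym ord0) => /eqP.
have h0 : h ord0 = tau *: y - 'X_p by rewrite /h /= scale1r.
(* These are the indices strictly between [ord0] and [ord_max]. *)
have hi (i : 'I_d) : h (widen_ord (leqnSn d.+1) (lift ord0 i)) = tau *: y.
  by rewrite /h -!val_eqE /= /bump /= add1n eqSS ltn_eqF //= scale0r subr0.
have hm : h ord_max = y by rewrite /h eqxx.
have ell : cong E (\sum_j 'X_j) (Lam *: y - 'X_p).
  have -> : Lam *: y - 'X_p = \sum_s h s.
    rewrite big_ord_recr /= hm big_ord_recl /= (eq_bigr (fun=> tau *: y)) => [|i _]; last exact: hi.
    rewrite (_ : widen_ord _ _ = ord0) ?h0; last exact: val_inj.
    rewrite sumr_const card_ord /Lam -scaler_nat scalerA scalerDl scale1r -(addn1 d) natrD mulrDl.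
    by rewrite mul1r !scalerDl; ring.
  move=> r; rewrite sumF !mulrDl !linearD /= (Xq r) mulNr linearN /= subrr addr0.
  rewrite [X in _ + X](_ : _ = 0) ?addr0.
    by rewrite !mulr_suml !linear_sum; apply: eq_bigr => s _; apply: Xf.
  rewrite mulr_suml linear_sum big1 // => j /and3P[jF jp jq].
  by rewrite (other j) // mul0r linear0.
set Y := E (y ^+ d.+2); set Z := E (y ^+ d.+1 * 'X_p).
have small : cong E (\prod_(s | s != ord_max) 'X_(f s)) ((tau *: y - 'X_p) * (tau *: y) ^+ d).
  have -> : (tau *: y - 'X_p) * (tau *: y) ^+ d = \prod_(s | s != ord_max) h s.
    rewrite big_mkcond big_ord_recr /= eqxx mulr1 big_ord_recl /=; congr (_ * _).
      by rewrite -h0; congr h; apply: val_inj.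
    rewrite (eq_bigr (fun=> tau *: y)) ?prodr_const ?card_ord // => i _.
    by rewrite hi -val_eqE /= /bump /= add1n eqSS ltn_eqF.
  by apply: cong_prod => s _.
(* As [F] is a non-face this value is 0, which ties [Y] to [Z]. *)
have EF : E (\prod_(j in F) 'X_j) = tau ^+ d.+1 * Y - tau ^+ d * Z.
  rewrite big_imset /=; last by move=> ? ? _ _; apply: injf.
  rewrite (bigD1 ord_max) //= mulrC small -/y !mulrBl linearB /= exprZn.
  rewrite -!scalerAl -!scalerAr -!scalerAl !linearZ /= mulrA -exprS /Y /Z !exprS.
  by congr (_ * E _ - _ * E _); ring.
have EF0 : E (\prod_(j in F) 'X_j) = 0.
  have [m mF <-] := mpolyX_set R F.
  by rewrite -['X_[m]]mulr1 (degree_form_nonface cplx degE) // mF.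
have YZ : tau * Y = Z.
  apply: (mulfI (expf_neq0 d tau0)); apply/eqP; rewrite mulrA -exprSr -subr_eq0 -EF EF0 //.
(* The normalisation at the facet [p |: F :\ f ord_max] has a non-zero right-hand side, while its
   monomial reduces to [tau ^+ d.+1 * Z]. *)
have Z0 : Z != 0.
  have := Ex _ p_facet; rewrite big_setU1 /=; last by rewrite !inE (negPf pF) andbF.
  have -> : F :\ f ord_max = f @: [set s | s != ord_max].
    apply/setP=> j; apply/setD1P/imsetP => [[jm /imsetP[s _ js]]|[s]].
      by exists s => //; rewrite inE; apply: contra jm => /eqP <-; rewrite js.
    by rewrite inE => sm ->; rewrite (inj_eq injf) imset_f.
  rewrite big_imset /=; last by move=> ? ? _ _; apply: injf.
  rewrite (eq_bigl (fun s => s != ord_max)) => [|s]; last by rewrite inE.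
  have -> : E ('X_p * \prod_(s | s != ord_max) 'X_(f s)) = tau ^+ d.+1 * Z.
    rewrite mulrC small mulrAC !mulrBl linearB /= (XpXp _).
    rewrite mul0r linear0 subr0 exprZn -!scalerAl -!scalerAr !linearZ /= mulrA -exprS /Z.
    by congr (_ * E _); rewrite exprS; ring.
  set G := p |: _ => e; apply: contraTneq (mulf_neq0 (eps0 G) c0) => Z0.
  by rewrite -e negbK Z0 mulr0 mul0r.
have e : tau * E ((\sum_j 'X_j) ^+ d.+2) = Lam ^+ d.+1 * (1 - tau) * Z.
  rewrite (congE (congX d.+2 ell)) (congE (cong_binomial _ d.+1 XpXp)) linearB /= linearZ /=.
  rewrite !exprZn -scalerAl !linearZ /= -/Y -/Z mulrBr exprSr.
  transitivity (Lam ^+ d.+1 * (Lam * (tau * Y) - d.+2%:R * tau * Z)); first by ring.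
  by rewrite YZ /Lam -(addn1 d.+1) natrD; ring.
apply: contraNneq Z0 => E0; move: e; rewrite E0 mulr0 => /esym/eqP.
by rewrite !mulf_eq0 expf_eq0 (negPf Lam0) (negPf tau1) andbF.
Qed.

End Suspension.

(** * Non-vanishing after specialisation *)

Section SuspensionComplex.

Variables (k : fieldType) (n d : nat) (Delta : {set {set 'I_n}}) (F : {set 'I_n}).
Hypothesis cplx : simplicial_complex Delta.
Hypothesis dimD : has_dim d.+2 Delta.
Hypothesis manD : homology_manifold k d.+2 Delta.
Hypothesis Fd : #|F| = d.+2.
Hypothesis FD : F \notin Delta.
Hypothesis near : forall G, facet Delta G -> (d < #|F :&: G|)%N.

Let facetd := facetE cplx dimD manD.

Lemma facet_near_shape G : facet Delta G ->
  exists w u, [/\ w \in F, u \notin F & G = u |: F :\ w].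
Proof.
move=> fG; have Gd := card_facet cplx dimD manD fG; have GD : G \in Delta by case/andP: fG.
have FG : #|F :&: G| = d.+1.
  apply/eqP; rewrite eqn_leq near // andbT leqNgt; apply: contra FD => big.
  suff -> : F = G by [].
  have: F :&: G == F by rewrite eqEcard subsetIl Fd.
  by move/eqP/setIidPl => sFG; apply/eqP; rewrite eqEcard sFG Fd Gd leqnn.
have /eqP/cards1P[u uE] : #|G :\: F| = 1%N.
  by have := cardsID F G; rewrite setIC FG Gd => e; apply: (@addnI d.+1); rewrite e addn1.
have /eqP/cards1P[w wE] : #|F :\: G| = 1%N.
  by have := cardsID G F; rewrite FG Fd => e; apply: (@addnI d.+1); rewrite e addn1.
have /setDP[wF wG] : w \in F :\: G by rewrite wE inE.
have /setDP[uG uF] : u \in G :\: F by rewrite uE inE.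
exists w, u; split=> //; apply/setP=> z; rewrite !inE.
move/setP/(_ z): uE; move/setP/(_ z): wE; rewrite !inE.
case: (z =P w) => [->|_] /=; first by rewrite (negPf wG) orbF => _ _; apply/esym; apply: contraNF wG => /eqP ->.
by case: (z \in G); case: (z \in F); case: (z == u).
Qed.

(** The ridge [u |: F :\ w :\ w'] lies in a second facet. That facet again misses one vertex of [F]
    and has apex [u], and the missed vertex can only be [w']. *)
Lemma facet_rotate w w' u : w \in F -> w' \in F -> u \notin F ->
  facet Delta (u |: F :\ w) -> facet Delta (u |: F :\ w').
Proof.
move=> wF w'F uF fG; have [<-//|ww'] := eqVneq w w'.
have Gd := card_facet cplx dimD manD fG; have GD : u |: F :\ w \in Delta by case/andP: fG.
have uw' : w' != u by apply: contraNneq uF => <-.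
have w'G : w' \in u |: F :\ w by rewrite !inE w'F andbT [w' == w]eq_sym ww' orbT.
have Hd : #|(u |: F :\ w) :\ w'| = d.+1.
  by have := cardsD1 w' (u |: F :\ w); rewrite w'G Gd add1n => -[].
have HD : (u |: F :\ w) :\ w' \in Delta by apply: cplx GD _; apply: subD1set.
have [|G [fG' HG' G'G]] := facet_avoiding cplx dimD manD (u |: F :\ w) HD; first by rewrite Hd ltnSn.
have [x [u' [xF u'F GE]]] := facet_near_shape fG'.
have uu' : u = u'.
  have /(subsetP HG') : u \in (u |: F :\ w) :\ w' by rewrite !inE eqxx eq_sym uw'.
  by rewrite GE !inE (negPf uF) andbF orbF => /eqP.
rewrite -uu' in GE; rewrite {u' u'F uu'}.
have [xw'|xw'] := eqVneq x w'; first by rewrite -xw' -GE.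
have xw : x != w by apply: contraNneq G'G => <-; rewrite GE.
have /(subsetP HG') : x \in (u |: F :\ w) :\ w' by rewrite !inE xw' xF xw orbT.
by rewrite GE !inE eqxx /= orbF => /eqP xu; move: uF; rewrite -xu xF.
Qed.

(** The poles are the apexes of the two facets through a ridge [F :\ w]; rotation brings the apex of
    every facet over this ridge. *)
Lemma suspension_poles : exists p q, [/\ p \notin F, q \notin F, p != q,
  forall w, w \in F -> facet Delta (p |: F :\ w) &
  forall G, facet Delta G -> exists w u, [/\ w \in F, u \in [set p; q] & G = u |: F :\ w]].
Proof.
have [[G GD Gd] _] := dimD.
have fG : facet Delta G by rewrite facetd GD Gd eqxx.
have [w [u [wF uF GE]]] := facet_near_shape fG.
have Hd : #|F :\ w|.+1 = d.+2 by rewrite -Fd (cardsD1 w F) wF.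
have HD : F :\ w \in Delta by apply: cplx GD _; rewrite GE subsetUr.
have H0 : (0 < #|F :\ w|)%N by move: Hd => -[->].
have /eqP/cards2P[p [q [pq W]]] := card_ridge_link cplx dimD manD HD H0 Hd.
have inW v : v \in [set p; q] -> v \notin F /\ facet Delta (v |: F :\ w).
  rewrite -W inE => /andP[vH vD].
  have vF : v \notin F.
    apply: contra vH => vF; rewrite !inE vF andbT; apply: contraNneq FD => vw.
    by move: vD; rewrite vw setD1K.
  by split=> //; rewrite facetd vD cardsU1 vH add1n Hd eqxx.
have [pF pole_p] : p \notin F /\ facet Delta (p |: F :\ w) by apply: inW; rewrite !inE eqxx.
have [qF _] : q \notin F /\ facet Delta (q |: F :\ w) by apply: inW; rewrite !inE eqxx orbT.
exists p, q; split=> // [w' w'F|G' fG']; first exact: facet_rotate pole_p.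
have [w' [u' [w'F u'F G'E]]] := facet_near_shape fG'.
exists w', u'; split=> //; rewrite -W !inE (negPf u'F) andbF /=.
rewrite G'E in fG'; have := facet_rotate w'F wF u'F fG'.
by rewrite facetd => /andP[].
Qed.

End SuspensionComplex.

Section NonVanishing.

Variables (k : fieldType) (n d : nat) (Delta : {set {set 'I_n}}) (N : {set 'I_n} -> nat).
Hypothesis cplx : simplicial_complex Delta.
Hypothesis dimD : has_dim d.+2 Delta.
Hypothesis manD : homology_manifold k d.+2 Delta.

Local Notation A := (Pa k d.+2 n).
Local Notation K := (KK k d.+2 n).
Local Notation generic_mx := (generic_mx k d.+2 n).
Let eps (F : {set 'I_n}) : A := (-1) ^+ N F.

Let facetd := facetE cplx dimD manD.
Let pure := @in_facet n Delta.

(* Zeros in the first row on [Z] and in the last row on [Z'] kill the brackets of [Z] and [Z'];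
   when [#|Z :&: Z'| <= d], no other bracket is killed. *)
Definition corner (Z Z' : {set 'I_n}) (i : 'I_d.+2) (j : 'I_n) :=
  ((i == ord0) ==> (j \notin Z)) && ((i == ord_max) ==> (j \notin Z')).

Definition corner_mask (Z Z' : {set 'I_n}) : 'M[A]_(d.+2, n) := mask_mx k (corner Z Z').

Lemma bracket_of_corner_last (Z F : {set 'I_n}) : bracket_of (corner_mask Z F) F = 0.
Proof.
by apply: (@bracket_of_row0 _ _ _ _ _ ord_max) => j jF; rewrite mxE /corner eqxx jF andbF.
Qed.

Lemma bracket_of_corner_first (F Z : {set 'I_n}) : bracket_of (corner_mask F Z) F = 0.
Proof.
by apply: (@bracket_of_row0 _ _ _ _ _ ord0) => j jF; rewrite mxE /corner eqxx jF.
Qed.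

(** A transversal that uses [x] in the first row and [y] in the last avoids all the zeros. *)
Lemma bracket_of_corner_neq0 (Z Z' G : {set 'I_n}) x y : #|G| = d.+2 -> x \in G -> y \in G -> x != y ->
  x \notin Z -> y \notin Z' -> bracket_of (corner_mask Z Z') G != 0.
Proof.
move=> Gd xG yG xy xZ yZ'; have [s [injs Gs _]] := bracket_of_enum Gd.
have [i _ xi] : exists2 i, i \in 'I_d.+2 & x = s i by apply/imsetP; rewrite -Gs.
have [j _ yj] : exists2 j, j \in 'I_d.+2 & y = s j by apply/imsetP; rewrite -Gs.
have ij : i != j by apply: contraNneq xy => ij; rewrite xi yj ij.
(* [t] sends the first row to [i]; [t'] then sends the last one to [j] and fixes [i]. *)
pose t := tperm ord0 i; pose t' := tperm (t ord_max) j.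
have t0 : t' (t ord0) = i.
  by rewrite /t tpermL /t' tpermD // 1?eq_sym // -(inj_eq (@perm_inj _ t)) tpermR /t tpermK.
have tm : t' (t ord_max) = j by rewrite /t' tpermL.
have inj' : injective (fun a => s (t' (t a))) by move=> a b /injs/perm_inj/perm_inj.
apply: (@bracket_of_mask_neq0 k d.+2 n (corner Z Z') _ G Gd inj') => a; first by rewrite Gs imset_f.
apply/andP; split; apply/implyP=> /eqP ->; last by rewrite tm -yj.
by rewrite t0 -xi.
Qed.

Lemma bracket_generic_neq0 G : facet Delta G -> bracket_of generic_mx G != 0.
Proof.
move=> /(card_facet cplx dimD manD) Gd; have [s [injs Gs _]] := bracket_of_enum Gd.
rewrite (_ : generic_mx = mask_mx k (fun _ _ => true)); last by apply/matrixP=> i j; rewrite !mxE.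
by apply: (bracket_of_mask_neq0 k Gd injs) => // i; rewrite Gs imset_f.
Qed.

Lemma subst_bracket_of v G : subst v (bracket_of generic_mx G) = bracket_of v G.
Proof. by rewrite -bracket_of_map subst_generic_mx. Qed.

Lemma facet_not_sub G (H : {set 'I_n}) : facet Delta G -> #|H| = d.+2 -> G != H ->
  exists2 x, x \in G & x \notin H.
Proof.
move=> /(card_facet cplx dimD manD) Gd Hd GH.
have /subsetPn[x] : ~~ (G \subset H); last by exists x.
by apply: contra GH => sGH; rewrite eqEcard sGH Gd Hd leqnn.
Qed.

Lemma facet_other G y : facet Delta G -> exists2 x, x \in G & x != y.
Proof.
move=> /(card_facet cplx dimD manD) Gd.
have /card_gt0P[x] : (0 < #|G :\ y|)%N.
  have := cardsD1 y G; rewrite Gd.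
  by case: (y \in G); rewrite ?add1n ?add0n; [case=> <- | move=> <-].
by rewrite !inE => /andP[]; exists x.
Qed.

(** The denominator without its simple factor [[G0]]. *)
Definition codenominator (G0 : {set 'I_n}) : A :=
  (\prod_(G | facet Delta G && (G != G0)) bracket_of generic_mx G) *
  (\prod_(G | facet Delta G && (G != G0)) bracket_of generic_mx G) ^+ d.+2.

Lemma denominatorE G0 : facet Delta G0 ->
  denominator Delta generic_mx (fun G => G != G0) = bracket_of generic_mx G0 * codenominator G0.
Proof. by move=> fG0; rewrite /denominator (bigD1 G0) //= -mulrA. Qed.

Lemma subst_codenominator_neq0 v G0 :
  (forall G, facet Delta G -> G != G0 -> bracket_of v G != 0) -> subst v (codenominator G0) != 0.
Proof.
move=> v0; have v1 : subst v (\prod_(G | facet Delta G && (G != G0)) bracket_of generic_mx G) != 0.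
  by rewrite rmorph_prod; apply/prodf_neq0 => G /andP[fG GG0]; rewrite -[X in X != 0]/(subst v _) subst_bracket_of v0.
by rewrite rmorphM rmorphXn mulf_neq0 ?expf_neq0.
Qed.

Lemma subst_denominator_neq0 v B :
  (forall G, facet Delta G -> bracket_of v G != 0) -> subst v (denominator Delta generic_mx B) != 0.
Proof.
move=> v0; rewrite rmorphM rmorphXn mulf_neq0 ?expf_neq0 // rmorph_prod.
  by apply/prodf_neq0 => G fG; rewrite -[X in X != 0]/(subst v _) subst_bracket_of v0.
by apply/prodf_neq0 => G /andP[fG _]; rewrite -[X in X != 0]/(subst v _) subst_bracket_of v0.
Qed.

Lemma map_ell (R S : nzRingType) (f : {rmorphism R -> S}) :
  map_mpoly f ((\sum_(j < n) 'X_j) ^+ d.+2) = (\sum_(j < n) 'X_j) ^+ d.+2.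
Proof.
by rewrite rmorphXn rmorph_sum; congr (_ ^+ _); apply: eq_bigr => j _; apply: map_mpolyX.
Qed.

(** The specialisation kills [[G0]], hence the denominator, but no other facet bracket. So the
    specialised form vanishes on the other facets and [residue_power] applies. The set [Z] leaves
    room for killing a second bracket. *)
Lemma residue_ell_neq0 (E : {scalar {mpoly A[n]}}) (G0 Z : {set 'I_n}) :
  degree_form Delta generic_mx (denominator Delta generic_mx (fun G => G != G0)) eps E ->
  facet Delta G0 -> ~~ (G0 \subset Z) ->
  (forall G, facet Delta G -> G != G0 ->
    exists x y, [/\ x \in G, y \in G, x != y, x \notin Z & y \notin G0]) ->
  subst (corner_mask Z G0) (E ((\sum_j 'X_j) ^+ d.+2)) != 0.
Proof.
move=> degE fG0 G0Z others; set v := corner_mask Z G0.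
have Gd := card_facet cplx dimD manD fG0.
have vG0 : bracket_of v G0 = 0 by apply: bracket_of_corner_last.
have vG G : facet Delta G -> G != G0 -> bracket_of v G != 0.
  move=> fG GG0; have [x [y [xG yG xy xZ yG0]]] := others G fG GG0.
  exact: bracket_of_corner_neq0 (card_facet cplx dimD manD fG) xG yG xy xZ yG0.
have [E' [degE' E'E]] := degree_form_map (subst v) degE.
rewrite subst_generic_mx in degE'; rewrite -E'E map_ell.
have [_ _ _ Ex] := degE; have [_ _ _ Ex'] := degE'.
have E'G G : facet Delta G -> G != G0 -> E' (\prod_(j in G) 'X_j) = 0.
  move=> fG GG0; apply: (mulIf (vG _ fG GG0)); rewrite mul0r Ex' //=.
  by rewrite denominatorE // rmorphM [X in _ * (X * _)]subst_bracket_of vG0 mul0r mulr0.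
(* The factor [[G0]] has to be cancelled before the specialisation, while it is non-zero. *)
have E'G0 : E' (\prod_(j in G0) 'X_j) != 0.
  have EG0 : E (\prod_(j in G0) 'X_j) = eps G0 * codenominator G0.
    apply: (mulIf (bracket_generic_neq0 fG0)); rewrite Ex // denominatorE //.
    by rewrite [bracket_of _ _ * _]mulrC mulrA.
  rewrite (_ : \prod_(j in G0) 'X_j = map_mpoly (subst v) (\prod_(j in G0) 'X_j)); last first.
    by rewrite rmorph_prod; apply: eq_bigr => j _; apply/esym/map_mpolyX.
  rewrite E'E EG0 rmorphM rmorph_sign mulf_neq0 ?signr_eq0 //.
  exact: subst_codenominator_neq0.
have [s [injs G0s _]] := bracket_of_enum Gd.
have /subsetPn[x xG0 xZ] := G0Z.
have [i _ xi] : exists2 i, i \in 'I_d.+2 & x = s i by apply/imsetP; rewrite -G0s.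
(* The last row is zero on [G0], so only its own cofactors can be non-zero. The first row keeps its
   entry at [x]. *)
have Lam0 : \sum_i cofactor (colsub s v) ord_max i != 0.
  apply: (@cofactor_mask_neq0 _ _ _ _ s (tperm ord0 i)) => //.
    by exists (tperm ord0 i); apply: tpermK.
  move=> j jm; rewrite /corner (negPf jm) andbT; apply/implyP=> /eqP ->.
  by rewrite tpermL -xi.
apply: contraTneq (mulf_neq0 (expf_neq0 d.+2 Lam0) E'G0) => E0.
have := residue_power facetd pure degE' vG E'G ord_max injs G0s.
by rewrite E0 mulr0 => <-; rewrite eqxx.
Qed.

Lemma suspension_subst_ell_neq0 (E : {scalar {mpoly A[n]}}) (F : {set 'I_n}) :
  degree_form Delta generic_mx (denominator Delta generic_mx predT) eps E ->
  #|F| = d.+2 -> F \notin Delta -> (forall G, facet Delta G -> (d < #|F :&: G|)%N) ->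
  exists v, [/\ bracket_of v F = 0, subst v (denominator Delta generic_mx predT) != 0 &
    subst v (E ((\sum_j 'X_j) ^+ d.+2)) != 0].
Proof.
move=> degE Fd FD near.
have [p [q [pF qF pq pfacet shape]]] := suspension_poles cplx dimD manD Fd FD near.
have [f [injf Ff _]] := bracket_of_enum Fd.
(* With an indeterminate for [tau], the three non-vanishing conditions hold in every characteristic,
   as evaluation at a constant point shows. *)
pose tau : A := avar k ord0 (f ord0).
have at0 (x : A) w : x.@[w] = 1 -> x != 0.
  by move=> x1; apply: contraTneq (oner_neq0 k) => x0; rewrite -x1 x0 meval0 eqxx.
have tau0 : tau != 0 by apply: (at0 _ (fun=> 1)); rewrite /tau /avar mevalXU.
have tau_at0 : tau.@[fun=> 0] = 0 by rewrite /tau /avar mevalXU.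
have shape' G : facet Delta G -> exists w u, u \in [set p; q] /\ G = u |: F :\ f w.
  move=> /shape[w [u [wF uW GE]]]; move: wF; rewrite {1}Ff => /imsetP[i _ wi].
  by exists i, u; rewrite -wi.
move: FD pF qF shape' pfacet; rewrite {1 2 3}Ff => FD pF qF shape' pfacet.
pose v := suspension_matrix tau f p q.
have vF : bracket_of v F = 0.
  apply: (@bracket_of_row0 _ _ _ _ _ ord_max) => j; rewrite Ff => /imsetP[s _ ->].
  by rewrite mxE (pole_p pF) (pole_q qF) eqxx mulr0n; case: eqP.
have vG G : facet Delta G -> bracket_of v G != 0.
  by move=> /shape'[w [u [uW ->]]]; rewrite Ff; apply: suspension_bracket_of.
have den0 := subst_denominator_neq0 predT vG.
exists v; split=> //.
have [E' [degE' E'E]] := degree_form_map (subst v) degE.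
rewrite subst_generic_mx in degE'; rewrite -E'E map_ell.
rewrite Ff in shape' pfacet.
apply: (suspension_ell_neq0 injf pF qF pq cplx pure shape' FD _ degE') => //.
- by apply: pfacet; apply: imset_f.
- by move=> G; rewrite /= rmorph_sign signr_eq0.
- by apply: (at0 _ (fun=> 0)); rewrite mevalB meval1 tau_at0 subr0.
- by apply: (at0 _ (fun=> 0)); rewrite mevalD meval1 mevalM tau_at0 mulr0 addr0.
Qed.

End NonVanishing.

(** * Orders of vanishing along brackets *)

Lemma not_pdvd (R S : comNzRingType) (f : {rmorphism R -> S}) (x y : R) :
  f x = 0 -> f y != 0 -> ~ pdvd x y.
Proof. by move=> fx fy [z yE]; rewrite yE rmorphM fx mul0r eqxx in fy. Qed.

(** Signs are stored as exponents of -1, so that they already live in the polynomial ring; exponent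
    0 gives the convention of [epsF] in characteristic 2. *)
Lemma is_deg_form (k : fieldType) (d n : nat) (Delta : {set {set 'I_n}})
    (ord : {set 'I_n} -> seq 'I_n) (D : {mpoly (KK k d n)[n]} -> KK k d n) :
  (forall F, facet Delta F -> bracket_of (generic_mx k d n) F != 0) -> is_deg Delta ord D ->
  exists (N : {set 'I_n} -> nat) (D' : {scalar {mpoly (KK k d n)[n]}}), D' =1 D /\
    degree_form Delta (map_mx (@tofrac (Pa k d n)) (generic_mx k d n)) 1
      (@tofrac (Pa k d n) \o (fun F => (-1) ^+ N F)) D'.
Proof.
move=> brk0 [Dlin Dd Df Dt Dx].
pose M := GRing.isLinear.Build (KK k d n) {mpoly (KK k d n)[n]} (KK k d n) *%R D Dlin.
pose D' : {scalar {mpoly (KK k d n)[n]}} := HB.pack D M.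
exists (fun F => if (2 \in [pchar k])%N then 0%N else inv_count (ord F)), D'; split=> //.
split=> //= [i q|F fF].
  rewrite -[RHS](Dt i q); congr (D (_ * _)); apply: eq_bigr => j _.
  by rewrite !mxE.
rewrite -[\prod_(j in F) _]/(xF _ F) (Dx F fF) bracket_of_map bracket_generic_mx divfK ?tofrac_eq0 ?brk0 //.
rewrite mulr1 /epsF /seq_sign; case: ifP => _; first by rewrite expr0 rmorph1.
by rewrite !rmorphXn !rmorphN1.
Qed.

Theorem theorem1p4 (k : fieldType) (d n : nat) (Delta : {set {set 'I_n}})
  (ord : {set 'I_n} -> seq 'I_n) (D : {mpoly (KK k d n)[n]} -> KK k d n) :
  (2 <= d)%N ->
  simplicial_complex Delta -> has_vertex_set Delta -> has_dim d Delta ->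
  connected_complex Delta -> homology_manifold k d Delta ->
  (~~ (2 \in [pchar k])%N -> is_orientation Delta ord) ->
  is_deg Delta ord D ->
  D (ellp _ n ^+ d) != 0 /\
  forall F : {set 'I_n}, #|F| = d ->
    ord_is (bracket k d F) (D (ellp _ n ^+ d)) (if facet Delta F then -1 else 0).
Proof.
case: d D => [|[|d]] // D _ cplx _ dimD _ manD _ degD.
have [N [D' [D'D degD']]] := is_deg_form (bracket_generic_neq0 cplx dimD manD) degD.
rewrite -{}D'D {D degD}; set x := D' _.
have facetd := facetE cplx dimD manD.
have brk0 := bracket_generic_neq0 cplx dimD manD.
pose A := Pa k d.+2 n; pose ell : {mpoly A[n]} := (\sum_j 'X_j) ^+ d.+2.
(* Excluding one facet from [B] leaves its bracket a simple factor of the denominator. *)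
have integral (B : pred {set 'I_n}) : (forall s, s \in Delta -> (0 < #|s| < d.+2)%N ->
      exists G, [/\ facet Delta G, s \subset G & B G]) ->
    exists E : {scalar {mpoly A[n]}},
      degree_form Delta (generic_mx k d.+2 n) (denominator Delta (generic_mx k d.+2 n) B)
        (fun F => (-1) ^+ N F) E /\
      x = tofrac (E ell) / tofrac (denominator Delta (generic_mx k d.+2 n) B).
  move=> cov; have [E [degE EE]] := integral_degree_form facetd degD' isT cov.
  exists E; split=> //; apply: (canRL (mulfK _)); last by rewrite EE map_ell mulrC.
  rewrite tofrac_eq0.
  by rewrite mulf_neq0 ?expf_neq0 //; apply/prodf_neq0 => G; [|case/andP]; move=> /brk0.
have facet_case F : facet Delta F -> ord_is (bracket k d.+2 F) x (-1).
  move=> fF; have Fd := card_facet cplx dimD manD fF.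
  have others G : facet Delta G -> G != F ->
      exists u w, [/\ u \in G, w \in G, u != w, u \notin set0 & w \notin F].
    move=> fG GF; have [w wG wF] := facet_not_sub cplx dimD manD fG Fd GF.
    have [u uG uw] := facet_other cplx dimD manD w fG.
    by exists u, w; rewrite uG wG uw inE wF.
  have [E [degE xE]] := integral _ (fun s => facet_avoiding cplx dimD manD F (s := s)).
  exists (E ell), (codenominator k d Delta F); rewrite bracket_generic_mx; split.
  - apply: (@not_pdvd _ _ (subst (corner_mask k d set0 F))); first by rewrite [LHS]subst_bracket_of bracket_of_corner_last.
    apply: residue_ell_neq0 degE fF _ others => //.
    by rewrite subset0 -card_gt0 Fd.
  - apply: (@not_pdvd _ _ (subst (corner_mask k d set0 F))); first by rewrite [LHS]subst_bracket_of bracket_of_corner_last.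
    apply: subst_codenominator_neq0 => G fG GF.
    have [u [w [uG wG uw u0 wF]]] := others G fG GF.
    exact: bracket_of_corner_neq0 (card_facet cplx dimD manD fG) uG wG uw u0 wF.
  - by rewrite xE denominatorE // tofracM invfM mulrCA mulrA -exprN1.
split.
  have [[G GD Gd] _] := dimD.
  have fG : facet Delta G by rewrite facetd GD Gd eqxx.
  have [f [g [nf ng ->]]] := facet_case G fG.
  have nz (y z : A) : ~ pdvd y z -> z != 0.
    by move=> yz; apply/eqP=> z0; apply: yz; exists 0; rewrite z0 mulr0.
  rewrite mulf_neq0 ?expfz_neq0 ?tofrac_eq0 //; first by rewrite bracket_generic_mx brk0.
  by rewrite mulf_neq0 ?invr_eq0 ?tofrac_eq0 ?(nz _ _ nf) ?(nz _ _ ng).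
move=> F Fd; case: ifP => [/facet_case //|/negbT nfF].
have FD : F \notin Delta by move: nfF; rewrite facetd Fd eqxx andbT.
have GF G : facet Delta G -> G != F by move=> fG; apply: contraTneq fG => ->.
(* Zeros on [F] in the last row kill [[F]] and no facet bracket, since every facet has a vertex
   outside [F]. *)
have den0 (B : pred {set 'I_n}) : ~ pdvd (bracket k d.+2 F) (denominator Delta (generic_mx k d.+2 n) B).
  apply: (@not_pdvd _ _ (subst (corner_mask k d set0 F))).
    by rewrite bracket_generic_mx [LHS]subst_bracket_of bracket_of_corner_last.
  apply: subst_denominator_neq0 => G fG; have Gd := card_facet cplx dimD manD fG.
  have [w wG wF] := facet_not_sub cplx dimD manD fG Fd (GF G fG).
  have [u uG uw] := facet_other cplx dimD manD w fG.
  by apply: bracket_of_corner_neq0 Gd uG wG uw _ wF; rewrite inE.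
suff [B [E [v [xE vF vE]]]] : exists (B : pred {set 'I_n}) (E : {scalar {mpoly A[n]}}) (v : 'M[A]_(d.+2, n)),
    [/\ x = tofrac (E ell) / tofrac (denominator Delta (generic_mx k d.+2 n) B),
        bracket_of v F = 0 & subst v (E ell) != 0].
  exists (E ell), (denominator Delta (generic_mx k d.+2 n) B); split=> //.
    by apply: not_pdvd vE; rewrite bracket_generic_mx [LHS]subst_bracket_of.
  by rewrite expr0z mul1r.
have [/existsP[G0 /andP[fG0 small]]|/existsPn near] :=
    boolP [exists G, facet Delta G && (#|F :&: G| <= d)%N].
  have G0d := card_facet cplx dimD manD fG0.
  have [E [degE xE]] := integral _ (fun s => facet_avoiding cplx dimD manD G0 (s := s)).
  (* First-row zeros on [F] kill [[F]], last-row zeros on [G0] kill [[G0]]. *)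
  exists (fun G => G != G0), E, (corner_mask k d F G0); split=> //; first exact: bracket_of_corner_first.
  apply: residue_ell_neq0 (degE) (fG0) _ _ => //.
    by have [u uG0 uF] := facet_not_sub cplx dimD manD fG0 Fd (GF _ fG0); apply/subsetPn; exists u.
  move=> G fG GG0; have Gd := card_facet cplx dimD manD fG.
  have [u uG uF] := facet_not_sub cplx dimD manD fG Fd (GF _ fG).
  have [w wG wG0] := facet_not_sub cplx dimD manD fG G0d GG0.
  (* If one vertex serves for both sets, another one is found because [G :\ u] has [d.+1] vertices
     and [F :&: G0] at most [d]. *)
  have [uw|uw] := eqVneq u w; last by exists u, w.
  have [z] : exists2 z, z \in G :\ u & z \notin F :&: G0.
    apply/subsetPn; apply: contraL small => /subset_leq_card.
    by have := cardsD1 u G; rewrite uG Gd add1n -ltnNge => -[<-].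
  rewrite !inE negb_and => /andP[zu zG] /orP[zF|zG0].
    by exists z, u; split=> //; rewrite uw.
  by exists u, z; rewrite eq_sym.
(* No facet bracket is to be killed here, so all of them may be repeated. *)
have [s sD s0|E [degE xE]] := integral predT.
  by have [G [fG sG _]] := facet_avoiding cplx dimD manD F sD s0; exists G.
have near' G : facet Delta G -> (d < #|F :&: G|)%N.
  by move=> fG; have := near G; rewrite fG -ltnNge.
have [v [vF _ vE]] := suspension_subst_ell_neq0 cplx dimD manD degE Fd FD near'.
by exists predT, E, v.
Qed.
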